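(* Let $G=\ast_{j\in J}A_j$ be a free product of groups with at least two nontrivial factors, and let $n\ge1$ be an integer. Put $$k(G,n)=\min\Bigl\{\mathrm{cl}(g^n)\;\Big|\; g\in G,\ g\text{ is not conjugate to elements of }\bigcup_{j\in J}A_j\Bigr\}$$ and $$N(G)=\min\bigl\{|\langle g\rangle|\;\big|\; g\in G\setminus\{1\}\bigr\}\in\{2,3,\dots\}\cup\{\infty\}.$$ Then $$\text{either}\quad k(G,n)=\left[\frac n2\right]-\left[\frac n{N(G)}\right]+1\quad\text{or}\quad k(G,n)=\left[\frac n2\right]-\left[\frac n{N(G)}\right]+2.$$ Moreover, $k(G,n)=\left[\frac n2\right]-\left[\frac n{N(G)}\right]+1$ if at least one of the following conditions is satisfied: a) $n$ is even and $\left[\frac n{N(G)}\right]$ is odd; b) $n$ is divisible by $N(G)$; c) $n\le N(G)$; d) $N(G)=2$.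
   Context: $[x]$ denotes the maximal integer not exceeding the real number $x$, and $[n/\infty]=0$ (no $n$ is divisible by $\infty$, and $n\le\infty$ always holds). The commutator length $\mathrm{cl}(g)$ of an element $g$ of a group $G$ is the minimal integer $k\ge0$ such that $g$ is a product of $k$ commutators $[x,y]=x^{-1}y^{-1}xy$ with $x,y\in G$; in particular $\mathrm{cl}(1)=0$, and $\mathrm{cl}(g)=\infty$ if $g$ is not a product of commutators. *)

(* Defs.v *)
(* groupType is the structure of possibly infinite groups. *)
From mathcomp Require Import all_boot.
From mathcomp Require Import finmap.
From mathcomp Require Import boolp classical_sets cardinality.

Set Implicit Arguments.
Unset Strict Implicit.
Unset Printing Implicit Defensive.

Local Open Scope classical_set_scope.
Local Open Scope group_scope.

Notation "{ 'ghom' G -> H }" := (UMagmaMorphism.type G H)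
  (at level 0, G at level 98, H at level 99, format "{ 'ghom'  G  ->  H }") : type_scope.

(* Free products are taken up to isomorphism: G is the free product of the A j
   along iota when it is their coproduct in the category of groups (this forces
   every iota j to be injective). *)
Definition is_free_product (J : Type) (A : J -> groupType) (G : groupType)
    (iota : forall j, {ghom A j -> G}) : Prop :=
  forall (H : groupType) (f : forall j, {ghom A j -> H}),
    (exists phi : {ghom G -> H}, forall j a, phi (iota j a) = f j a) /\
    (forall phi psi : {ghom G -> H},
       (forall j a, phi (iota j a) = f j a) ->
       (forall j a, psi (iota j a) = f j a) -> phi =1 psi).

Definition nontrivial (G : groupType) : Prop := exists g : G, g != 1.

(* Natural numbers extended by infinity: None is infinity. *)
Definition enat : Type := option nat.

Definition le_enat (x y : enat) : bool :=
  match x, y with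
  | _, None => true
  | None, Some _ => false
  | Some m, Some n => (m <= n)%N
  end.

(* The minimum of the empty set is infinity. *)
Definition min_enat (S : set enat) : enat :=
  xget None [set x | S x /\ forall y, S y -> le_enat x y].

(* [n / x], with [n / oo] = 0. *)
Definition divn_enat (n : nat) (x : enat) : nat :=
  if x is Some m then (n %/ m)%N else 0%N.

(* x divides n; infinity divides no integer. *)
Definition dvdn_enat (x : enat) (n : nat) : bool :=
  if x is Some m then (m %| n)%N else false.

(* [~ x, y] is x^-1 * y^-1 * x * y. *)
Definition prod_of_commutators (G : groupType) (k : nat) (g : G) : Prop :=
  exists s : seq (G * G), size s = k /\ g = \prod_(p <- s) [~ p.1, p.2].

Definition cl (G : groupType) (g : G) : enat :=
  min_enat [set x | exists2 k, x = Some k & prod_of_commutators k g].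

Definition cyclic_subgroup (G : groupType) (g : G) : set G :=
  [set x | exists m : nat, x = g ^+ m \/ x = g ^- m].

Definition card_enat (T : choiceType) (X : set T) : enat :=
  if `[< finite_set X >] then Some #|` fset_set X|%fset else None.

Definition conj_to_factor (J : Type) (A : J -> groupType) (G : groupType)
    (iota : forall j, {ghom A j -> G}) (g : G) : Prop :=
  exists (j : J) (a : A j) (x : G), g = iota j a ^ x.

Definition k_min (J : Type) (A : J -> groupType) (G : groupType)
    (iota : forall j, {ghom A j -> G}) (n : nat) : enat :=
  min_enat [set x | exists2 g : G, ~ conj_to_factor iota g & x = cl (g ^+ n)].

Definition N_min (G : groupType) : enat :=
  min_enat [set x | exists2 g : G, g != 1 & x = card_enat (cyclic_subgroup g)].

(* Main.v *)
(* Write L for the length of a cyclically reduced word w.  If w ^ n is a product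
   of k commutators, it bounds a surface of genus k mapped to a wedge of spaces
   with fundamental groups A_j.  Cutting the surface along the preimage of the
   base point gives two permutations of the nL letters of w ^ n: the cycles of p
   read the boundaries of the pieces lying in the factors, those of
   kappa = next * p^-1 (products read from left to right) go around the pieces
   lying over the base point.  If F cycles of p have trivial product and kappa
   has K cycles, then F + K >= nL + 1 - 2k.
   Every letter of w ^ n has a residue in Z/L.  An ascent of p at the letter
   kappa x, an ascent of kappa at x, and x being a last letter of w exclude each
   other and exhaust all cases, and every cycle moving the residue has an ascent
   and a descent.  Hence F + K <= nL - n + c, where c is the number of constant
   cycles of p with trivial product, each of length at least N(G).  Counting the
   descents as well bounds c by about 2n/N(G), and in the critical case where
   c <= 2[n/N(G)] could fail, every cycle winds exactly once around Z/L, which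
   bounds the constant corners in a window of half the length of w by n.
   Altogether 2k >= n + 1 - 2[n/N(G)].
   Taking N = 2 and k = 0 shows that torsion elements are conjugate into the
   factors.  The upper bound is attained by [a, b] = u v with u = a^-1 of order
   N(G) and v = a^b: exchanging two blocks of a product costs one commutator, and
   gathering powers of u and v until they reach N(G) shortens (u v)^n. *)
From HB Require Import structures.
Require Import Defs.
From mathcomp Require Import finmap boolp classical_sets cardinality.
From mathcomp Require Import all_boot fingroup perm generic_quotient.
From mathcomp Require Import zify.

Set Implicit Arguments.
Unset Strict Implicit.
Unset Printing Implicit Defensive.

Local Open Scope group_scope.

(** * Rotation and corner counting *)

Lemma sum_eq_pointwise (I : finType) (A : {pred I}) (F H : I -> nat) :
  (forall i, i \in A -> H i <= F i)%N ->
  (\sum_(i in A) F i <= \sum_(i in A) H i)%N ->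
  forall i, i \in A -> F i = H i.
Proof.
move=> leHF leFH i Ai; move: leFH; rewrite (bigD1 i) //= [leqRHS](bigD1 i) //=.
have := leHF i Ai; have : (\sum_(j in A | j != i) H j <= \sum_(j in A | j != i) F j)%N.
  by apply: leq_sum => j /andP[Aj _]; exact: leHF.
by lia.
Qed.

(** * Winding of permutation cycles around the residues modulo [L] *)

Section Winding.
Variables (X : finType) (t : {perm X}) (L : nat) (r : X -> nat).
Hypothesis r_lt : forall x, (r x < L)%N.

Definition ascent x := (r x < r (t x))%N.

(* The representative in [0, L) of r x - r (t x) modulo L. *)
Definition drop_length x :=
  if (r (t x) <= r x)%N then (r x - r (t x))%N else (r x + L - r (t x))%N.

Definition ascents (o : {set X}) := (\sum_(x | porbit t x == o) ascent x)%N.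

Lemma porbit_step x : porbit t (t x) = porbit t x.
Proof. exact: (porbit_perm t 1). Qed.

Lemma sum_porbits (F : X -> nat) :
  (\sum_x F x = \sum_(o in porbits t) \sum_(x | porbit t x == o) F x)%N.
Proof.
by rewrite (partition_big (porbit t) (mem (porbits t))) // => x _; exact: imset_f.
Qed.

Lemma sum_porbit_step (F : X -> nat) (o : {set X}) :
  (\sum_(x | porbit t x == o) F (t x) = \sum_(x | porbit t x == o) F x)%N.
Proof.
rewrite [RHS](reindex_inj (@perm_inj _ t)) /=.
by apply: eq_bigl => x; rewrite porbit_step.
Qed.

(* The number of ascents of an orbit is thus the number of times its residues wind
   downwards around Z/L. *)
Lemma sum_drop_length o :
  (\sum_(x | porbit t x == o) drop_length x = L * ascents o)%N.
Proof.
apply/eqP; rewrite -(eqn_add2l (\sum_(x | porbit t x == o) r x)).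
rewrite -{1}sum_porbit_step -big_split /ascents big_distrr -big_split /=.
apply/eqP/eq_bigr => x _; rewrite /drop_length /ascent.
by move: (r_lt x) (r_lt (t x)); case: (ltnP (r x) (r (t x))); rewrite ?muln0 ?muln1; lia.
Qed.

(** Without an ascent the nonnegative drops sum to zero, so the residue never changes along the
    cycle. *)
Lemma ascents_gt0 x : r (t x) != r x -> (0 < ascents (porbit t x))%N.
Proof.
move=> rx; rewrite lt0n; apply/eqP => a0.
have := sum_drop_length (porbit t x); rewrite a0 muln0 (bigD1 x) //=.
by rewrite /drop_length; move: (r_lt x) (r_lt (t x)); case: (leqP (r (t x)) (r x)); lia.
Qed.

(** Each drop is less than [L], while the drops of the cycle sum to [L] times its ascents. *)
Lemma ascents_lt x :
  r (t x) != r x ->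
  (ascents (porbit t x) < \sum_(y | porbit t y == porbit t x) 1)%N.
Proof.
move=> rx; have L0 : (0 < L)%N by have := r_lt x; lia.
rewrite -(ltn_pmul2l L0) -sum_drop_length big_distrr /=.
have lt_d y : (drop_length y < L * 1)%N.
  by rewrite /drop_length; move: (r_lt y) (r_lt (t y)); case: (leqP (r (t y)) (r y)); lia.
rewrite [ltnLHS](bigD1 x) //= [ltnRHS](bigD1 x) //=.
have := lt_d x.
have : (\sum_(i | (porbit t i == porbit t x) && (i != x)) drop_length i <=
  \sum_(i | (porbit t i == porbit t x) && (i != x)) L * 1)%N.
  by apply: leq_sum => y _; apply/ltnW/lt_d.
by lia.
Qed.

Lemma drop_length_pair x y :
  (ascents (porbit t x) <= 1)%N -> porbit t x = porbit t y -> x != y ->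
  (drop_length x + drop_length y <= L)%N.
Proof.
move=> a1 oxy nxy; have := sum_drop_length (porbit t x).
rewrite (bigD1 x) //= (bigD1 y) /=; last by rewrite oxy eqxx eq_sym.
by move: a1; case: (ascents _) => [|[|]] //; lia.
Qed.

End Winding.

(** The excess [T + U - P - K] vanishes. If it were [i + 1], then [big] would give
    [C >= 2q + 2 + i], whereas adding the two upper bounds by [M] gives [N * C <= 2n + i + 1]; this
    is impossible because [n < N * (q + 1)]. *)
Lemma tight_arith (S P C K M T U N n q m : nat) :
  (S <= P + C)%N -> (T + U + n = M)%N -> (P <= T)%N -> (T + P + N * C <= M)%N ->
  (K <= U)%N -> (U + K <= M)%N -> n = (q * N + m)%N -> (m < N)%N ->
  (M + 2 * q < S + K + n)%N -> (T + U = P + K)%N.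
Proof.
move=> h0 h1 h2 h3 h4 h5 dn mN big.
have [i ei] : exists i, (T + U = P + K + i)%N by exists (T + U - P - K)%N; lia.
case: i ei => [|i] ei; first by rewrite addn0 in ei.
have hC : (2 * q + 2 + i <= C)%N by lia.
have := leq_mul (leqnn N) hC; have : (i <= N * i)%N by rewrite leq_pmull //; lia.
by rewrite !mulnDr; lia.
Qed.

(** * Counting the cycles of [p] and [k] against the letters *)

Section CornerCount.
Variables (X : finType) (next : X -> X) (p k : {perm X}).
Variables (L n N : nat) (r : X -> nat) (S : {set {set X}}).
Hypothesis r_lt : forall x, (r x < L)%N.
Hypothesis p_k : forall x, p (k x) = next x.
Hypothesis r_next :
  forall x, r (next x) = if (r x).+1 == L then 0%N else (r x).+1.
Hypothesis r_k : forall x, r (k x) != r x.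
Hypothesis card_r : forall i, (i < L)%N -> (\sum_x (r x == i) = n)%N.
Hypothesis L_gt0 : (0 < L)%N.
Hypothesis S_orbits : S \subset porbits p.
Hypothesis S_const :
  forall x, porbit p x \in S -> (forall y, y \in porbit p x -> r (p y) = r y) ->
  (N <= #|porbit p x|)%N.

Let bend (o : {set X}) := [exists x, (porbit p x == o) && (r (p x) != r x)].
Let P := [set o in porbits p | bend o].
Let C := [set o in S | ~~ bend o].
Let T := (\sum_x ascent p r x)%N.
Let U := (\sum_x ascent k r x)%N.
Let dl := drop_length p L r.

Let card_porbit_sum x : (\sum_(y | porbit p y == porbit p x) 1 = #|porbit p x|)%N.
Proof. by rewrite sum1_card; apply: eq_card => y; rewrite -eq_porbit_mem. Qed.

Lemma card_S_le : (#|S| <= #|P| + #|C|)%N.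
Proof.
rewrite -cardsUI (leq_trans _ (leq_addr _ _)) //; apply: subset_leq_card.
apply/subsetP => o So; rewrite !inE So (subsetP S_orbits) //=.
by case: (bend o).
Qed.

Lemma total_ascents : (T + U + n = #|X|)%N.
Proof.
have L1 : (L.-1 < L)%N by rewrite prednK.
(* The last residue [L.-1] is taken by exactly [n] letters; reindexing [T] along [k] puts the three
   exclusive alternatives at one letter [x]. *)
rewrite -(card_r L1) /T (reindex_inj (@perm_inj _ k)) -!big_split /= -sum1_card.
apply: eq_bigr => x _; rewrite /ascent p_k r_next.
move: (r_k x) (r_lt x) (r_lt (k x)).
by case: eqP => [|_]; case: (ltngtP (r x) (r (k x))); case: eqP; case: ltngtP; lia.
Qed.

Lemma bendP o : o \in P -> exists2 x, o = porbit p x & r (p x) != r x.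
Proof.
by rewrite inE => /andP[_ /existsP[x /andP[/eqP <- rx]]]; exists x.
Qed.

Lemma straightP x : ~~ bend (porbit p x) ->
  forall y, porbit p y = porbit p x -> r (p y) = r y /\ r y = r x.
Proof.
move=> /existsPn st y oy.
have st' z : porbit p z = porbit p x -> r (p z) = r z.
  by move=> oz; have := st z; rewrite oz eqxx negbK => /eqP.
split; first exact: st'.
have : y \in porbit p x by rewrite -oy porbit_id.
case/porbitP => i ->; elim: i => [|i IHi]; first by rewrite expg0 perm1.
by rewrite expgSr permM st' // porbit_perm.
Qed.

Lemma bent_le_ascents : (#|P| <= T)%N.
Proof.
rewrite /T (sum_porbits p) -sum1_card.
rewrite [leqRHS](big_setID P) /= (leq_trans _ (leq_addr _ _)) //.
have -> : porbits p :&: P = P by apply/setIidPr/subsetP => o; rewrite inE => /andP[].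
by apply: leq_sum => o /bendP[x -> rx]; apply: (ascents_gt0 r_lt).
Qed.

Lemma card_C_orbit o : o \in C -> (N <= \sum_(x | porbit p x == o) 1)%N.
Proof.
rewrite inE => /andP[So st].
have /imsetP[x _ ox] := subsetP S_orbits _ So; rewrite {}ox in So st *.
rewrite card_porbit_sum; apply: S_const => // y; rewrite -eq_porbit_mem => /eqP.
by case/(straightP st).
Qed.

(** Cycle by cycle: a bent cycle has fewer ascents than letters, a cycle in [C] has no ascent and at
    least [N] letters, and any other cycle has at most as many ascents as letters. *)
Lemma ascents_bent_straight_le : (T + #|P| + N * #|C| <= #|X|)%N.
Proof.
have sP : P \subset porbits p by apply/subsetP => o; rewrite !inE => /andP[].
have sC : C \subset porbits p :\: P.
  apply/subsetP => o; rewrite !inE => /andP[/(subsetP S_orbits) -> st].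
  by rewrite (negbTE st).
have eT : T = (\sum_(o in P) ascents p r o + \sum_(o in C) ascents p r o +
    \sum_(o in porbits p :\: P :\: C) ascents p r o)%N.
  rewrite /T (sum_porbits p) (big_setID P) (setIidPr sP).
  by rewrite (big_setID (A := _ :\: P) C) (setIidPr sC) /= addnA.
have eX : #|X| = (\sum_(o in P) \sum_(x | porbit p x == o) 1 +
    \sum_(o in C) \sum_(x | porbit p x == o) 1 +
    \sum_(o in porbits p :\: P :\: C) \sum_(x | porbit p x == o) 1)%N.
  rewrite -sum1_card (sum_porbits p) (big_setID P) (setIidPr sP).
  by rewrite (big_setID (A := _ :\: P) C) (setIidPr sC) /= addnA.
rewrite -[#|P|]sum1_card mulnC -sum_nat_const eX eT.
have h1 : (\sum_(i in P) ascents p r i + \sum_(i in P) 1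
     <= \sum_(i in P) \sum_(x | porbit p x == i) 1)%N.
  rewrite -big_split; apply: leq_sum => o /bendP[x -> rx].
  by rewrite /= addn1; apply: (ascents_lt r_lt).
have h2 : (\sum_(i in C) ascents p r i + \sum_(i in C) N
     <= \sum_(i in C) \sum_(x | porbit p x == i) 1)%N.
  rewrite -big_split; apply: leq_sum => o oC; rewrite /ascents big1 ?card_C_orbit //.
  move=> y /eqP oy; move: oC; rewrite inE -oy => /andP[_ /straightP /(_ y)[]//].
  by rewrite /ascent => -> _; rewrite ltnn.
have h3 : (\sum_(i in porbits p :\: P :\: C) ascents p r i
     <= \sum_(i in porbits p :\: P :\: C) \sum_(x | porbit p x == i) 1)%N.
  by apply: leq_sum => o _; apply: leq_sum => x _; exact: leq_b1.
lia.
Qed.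

Lemma porbits_le_ascents : (#|porbits k| <= U)%N.
Proof.
rewrite /U (sum_porbits k) -sum1_card; apply: leq_sum => o /imsetP[x _ ->].
exact: (ascents_gt0 r_lt).
Qed.

Lemma ascents_porbits_le : (U + #|porbits k| <= #|X|)%N.
Proof.
rewrite /U -[#|porbits k|]sum1_card -sum1_card !(sum_porbits k).
rewrite -big_split; apply: leq_sum => o /imsetP[x _ ->].
by rewrite /= addn1; apply: (ascents_lt r_lt).
Qed.

(** * The extremal case: every cycle winds at most once *)

Section Tight.
Hypothesis p_tight : forall x, (ascents p r (porbit p x) <= 1)%N.
Hypothesis k_tight : forall x, (ascents k r (porbit k x) <= 1)%N.

(* [dl x = 0] means that p does not change the residue at x. *)
Let flat i := (\sum_x ((r x == i) && (dl x == 0%N)))%N.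
Let upto i m := (\sum_x ((r x == i) && (dl x <= m)%N))%N.
Let incoming i m := (\sum_x ((r (p x) == i) && (L - m <= dl x)%N))%N.
Let succ i := if i.+1 == L then 0%N else i.+1.

(* Both kappa-steps at f use up at most L, so a short drop of p at f forces a short
   rise of p into the residue following that of f. *)
Lemma upto_incoming i m : (m.+2 < L)%N -> (upto i m <= incoming (succ i) m.+2)%N.
Proof.
move=> mL; rewrite /incoming (reindex_inj (@perm_inj _ k)) /=.
apply: leq_sum => f _; case: (r f =P i) => //= rf; case: (leqP (dl f) m) => //= df.
rewrite p_k r_next rf eqxx /=.
(* Since [p f = next y] and [p (k f) = next f], the drops of [p] at [f] and [k f] are determined by
   those of [k] at [y] and [f]. *)
set y := k^-1 f; have kf : k y = f by rewrite permKV.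
have pf : r (p f) = if (r y).+1 == L then 0%N else (r y).+1.
  by rewrite -{1}kf p_k r_next.
have := drop_length_pair r_lt (k_tight y) (esym (porbit_step k y)).
rewrite kf => /(_ _); have yf : y != f.
  by apply: contra (r_k y) => /eqP e; rewrite kf -e.
move=> /(_ yf); have := p_k f => pkf.
move: df (r_k f) (r_k y) (r_lt f) (r_lt y) (r_lt (p f)) (r_lt (k f)).
rewrite /dl /drop_length pkf r_next kf pf.
move: (r f) (r y) (r (k f)) mL => a b c; clear.
by repeat case: ifP; lia.
Qed.

(* In an orbit winding once, a rise by at most m into residue i leaves at most m for
   the drops out of residue i. *)
Lemma incoming_upto i m : (m < L)%N -> (incoming i m + flat i <= upto i m)%N.
Proof.
move=> mL.
have -> : upto i m = (\sum_x ((r x == i) && (0 < dl x <= m)%N) + flat i)%N.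
  rewrite -big_split; apply: eq_bigr => x _; case: eqP => //= _.
  by case: (dl x) => [|d] //=; rewrite addn0.
rewrite leq_add2r /incoming !(sum_porbits p); apply: leq_sum => o _.
case: (boolP [exists e, (porbit p e == o) && ((r (p e) == i) && (L - m <= dl e)%N)]); last first.
  move/existsPn => no; rewrite big1 // => x ox; have := no x.
  by rewrite ox /= => /negbTE ->.
case/existsP => e /and3P[/eqP oe /eqP re de].
have nconst x : (0 < dl x)%N = (r (p x) != r x).
  rewrite /dl /drop_length; move: (r_lt x) (r_lt (p x)).
  by case: (leqP (r (p x)) (r x)); lia.
have rie : r e != i by rewrite eq_sym -re -nconst; lia.
apply: (@leq_trans (\sum_(x | porbit p x == o) ((r (p x) == i) && (r x != i)))%N).
  apply: leq_sum => x _; case: (r (p x) =P i) => //= rx; case: (leqP (L - m) (dl x)) => //= dx.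
  have nx := nconst x; rewrite rx eq_sym in nx; rewrite -nx; lia.
(* A cycle enters residue [i] as often as it leaves it: once the steps staying at [i] are added to
   both sides, this is reindexing by [p]. *)
apply: (@leq_trans (\sum_(x | porbit p x == o) ((r x == i) && (r (p x) != i)))%N).
  rewrite -(leq_add2r (\sum_(x | porbit p x == o) ((r (p x) == i) && (r x == i)))%N).
  rewrite -!big_split /=.
  have -> : (\sum_(x | porbit p x == o)
      (((r (p x) == i) && (r x != i)) + ((r (p x) == i) && (r x == i))) =
     \sum_(x | porbit p x == o) (r (p x) == i))%N.
    by apply: eq_bigr => x _; case: eqP; case: eqP.
  rewrite (sum_porbit_step p (fun x => (r x == i) : nat)).
  by apply: leq_sum => x _; case: eqP; case: eqP.
(* The entry [e] already uses a drop of at least [L - m], so each exit of the same cycle drops by at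
   most [m]. *)
apply: leq_sum => x /eqP ox; case: (r x =P i) => //= rx.
case: (eqVneq (r (p x)) i) => //= rpx.
rewrite nconst rx rpx /=.
have xe : x != e by apply: contraNneq rie => <-; apply/eqP.
have := drop_length_pair r_lt (p_tight x) _ xe; rewrite ox oe => /(_ erefl).
by rewrite -/dl; move: de; rewrite lt0b; lia.
Qed.

(** Passing to the next residue raises the admissible drop by two and absorbs the flat letters
    there: [upto j d <= incoming (j + 1) (d + 2)], and adding [flat (j + 1)] gives at most
    [upto (j + 1) (d + 2)]. The drop bound has to stay below [L], which limits the window to about
    half of the residues. *)
Lemma flat_window i m : (i + m <= L)%N -> (2 * m <= L.+1)%N ->
  (\sum_(i <= j < i + m) flat j <= n)%N.
Proof.
case: m => [|m]; first by rewrite addn0 big_geq.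
move=> iL mL; apply: (@leq_trans (upto (i + m) (2 * m))); last first.
  rewrite -(card_r (_ : i + m < L)%N); last by lia.
  by apply: leq_sum => x _; case: eqP => //= _; exact: leq_b1.
elim: m iL mL => [|m IHm] iL mL.
  by rewrite addn1 big_nat1 addn0; apply: leq_sum => x _; case: (dl x).
rewrite addnS big_nat_recr /=; last by lia.
have si : succ (i + m) = (i + m.+1)%N by rewrite /succ; case: eqP; lia.
have h1 : (2 * m.+1 = (2 * m).+2)%N by lia.
have := @upto_incoming (i + m) (2 * m); rewrite si -h1 => /(_ _) h2.
have := @incoming_upto (i + m.+1) (2 * m.+1); have := IHm.
by lia.
Qed.

(** A cycle in [C] consists of at least [N] flat letters, all of one residue. *)
Lemma card_C_window i m : (i + m <= L)%N -> (2 * m <= L.+1)%N -> (0 < N)%N ->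
  (\sum_(i <= j < i + m) \sum_(o in C) [exists x, (porbit p x == o) && (r x == j)]
     <= n %/ N)%N.
Proof.
move=> iL mL N0; rewrite leq_divRL // big_distrl /=.
apply: leq_trans (flat_window iL mL); apply: leq_sum => j _.
rewrite big_distrl /= /flat (sum_porbits p).
have sC : C \subset porbits p.
  by apply/subsetP => o; rewrite inE => /andP[/(subsetP S_orbits)].
rewrite [leqRHS](big_setID C) /= (setIidPr sC) (leq_trans _ (leq_addr _ _)) //.
apply: leq_sum => o oC; case: existsP => //= -[x /andP[/eqP ox /eqP rx]].
rewrite mul1n (leq_trans (card_C_orbit oC)) //; apply: leq_sum => y /eqP oy.
move: oC; rewrite inE -ox => /andP[_ /straightP /(_ y)]; rewrite ox => /(_ oy)[py yx].
by rewrite yx rx eqxx /= /dl /drop_length py leqnn subnn.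
Qed.

(** Two windows, of lengths [(L.+1)./2] and [L - (L.+1)./2], cover all residues. *)
Lemma card_C_tight : (0 < N)%N -> (#|C| <= 2 * (n %/ N))%N.
Proof.
move=> N0.
have le1 : (#|C| <= \sum_(0 <= j < L) \sum_(o in C)
    [exists x, (porbit p x == o) && (r x == j)])%N.
  rewrite exchange_big /= -sum1_card; apply: leq_sum => o; rewrite inE => /andP[So _].
  have /imsetP[x _ ox] := subsetP S_orbits _ So.
  rewrite (@big_cat_nat _ _ _ (r x)) //=; last exact/ltnW/r_lt.
  rewrite [X in (_ + X)%N]big_ltn ?r_lt //.
  case: existsP => [_|[]]; first by lia.
  by exists x; rewrite ox !eqxx.
apply: leq_trans le1 _; set m := (L.+1)./2.
have mL : (m <= L)%N by rewrite /m; lia.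
rewrite (@big_cat_nat _ _ _ m) //= mul2n -addnn leq_add //.
  by have := @card_C_window 0 m; rewrite add0n; apply => //; rewrite /m; lia.
by have := @card_C_window m (L - m); rewrite subnKC //; apply => //; rewrite /m; lia.
Qed.

End Tight.

(** A violation leaves no slack in the counts, so no cycle winds twice; then [card_C_tight] bounds
    [C] and contradicts the violation. *)
Lemma corner_count :
  (0 < N)%N -> (#|S| + #|porbits k| + n <= #|X| + 2 * (n %/ N))%N.
Proof.
move=> N0; rewrite leqNgt; apply/negP => big.
have h0 := card_S_le; have h1 := total_ascents; have h2 := bent_le_ascents.
have h3 := ascents_bent_straight_le.
have h4 := porbits_le_ascents; have h5 := ascents_porbits_le; have dn := divn_eq n N.
have rN : (n %% N < N)%N by rewrite ltn_mod.
have tight : (T + U = #|P| + #|porbits k|)%N.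
  move: h0 h1 h2 h3 h4 h5 dn rN big.
  move: #|S| #|P| #|C| #|porbits k| #|X| T U (n %/ N)%N (n %% N)%N.
  move=> ? ? ? ? ? ? ? ? ?; exact: tight_arith.
(* The total of the ascents equals its lower bound, one per bent cycle, so equality holds on every
   cycle. *)
have p_tight x : (ascents p r (porbit p x) <= 1)%N.
  rewrite (@sum_eq_pointwise _ (mem (porbits p)) (ascents p r) (fun o => o \in P)).
  - exact: leq_b1.
  - move=> o _; case: (boolP (o \in P)) => //= /bendP[y -> ry].
    exact: (ascents_gt0 r_lt).
  - rewrite /ascents -sum_porbits -/T.
    have -> : (\sum_(o in porbits p) (o \in P) = #|P|)%N; last by lia.
    rewrite -big_mkcondr sum1_card; apply: eq_card => o.
    by rewrite unfold_in /= !inE; case: (o \in porbits p).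
  - exact: imset_f.
have k_tight x : (ascents k r (porbit k x) <= 1)%N.
  rewrite (@sum_eq_pointwise _ (mem (porbits k)) (ascents k r) (fun=> 1%N)) //.
  - by move=> o /imsetP[y _ ->]; apply: (ascents_gt0 r_lt).
  - have UK : (U <= #|porbits k|)%N by lia.
    by rewrite /ascents -sum_porbits sum1_card.
  - exact: imset_f.
have := card_C_tight p_tight k_tight N0; lia.
Qed.

End CornerCount.

(** * Products of commutators *)

Section CommutatorProducts.
Variable G : groupType.
Implicit Types x y z u v b : G.
Local Notation P := (@prod_of_commutators G).

Lemma prod_comm1 : P 0 1.
Proof. by exists [::]; rewrite big_nil. Qed.

Lemma prod_comm_mul k l x y : P k x -> P l y -> P (k + l) (x * y).
Proof.
move=> [s [<- ->]] [t [<- ->]]; exists (s ++ t).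
by rewrite size_cat big_cat.
Qed.

Lemma prod_comm_comm x y : P 1 [~ x, y].
Proof. by exists [:: (x, y)]; rewrite big_seq1. Qed.

Lemma prod_comm_conj k x y : P k x -> P k (x ^ y).
Proof.
move=> [s [<- ->]]; exists [seq (p.1 ^ y, p.2 ^ y) | p <- s].
rewrite size_map big_map conjg_prod; split=> //.
by apply: eq_bigr => p _; rewrite conjRg.
Qed.

Lemma prod_comm_leq k l x : (k <= l)%N -> P k x -> P l x.
Proof.
move=> /subnKC <-; elim: (l - k)%N => [|m IHm] Px; first by rewrite addn0.
by rewrite addnS -addn1 -[x]mulg1 -(comm1g 1); apply: prod_comm_mul (IHm Px) (prod_comm_comm _ _).
Qed.

Lemma prod_comm_rot k x y : P k (x * y) -> P k (y * x).
Proof. by move/(prod_comm_conj x); rewrite conjgE !mulgA mulVg mul1g. Qed.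

(** Congruence up to [k] commutators; conjugation invariance makes it compatible with factors on
    both sides. *)
Definition eqc k x y := P k (x / y).

Lemma eqc_refl x : eqc 0 x x.
Proof. by rewrite /eqc mulgV; exact: prod_comm1. Qed.

Lemma eqc_trans y k l x z : eqc k x y -> eqc l y z -> eqc (k + l) x z.
Proof. by move=> xy /(prod_comm_mul xy); rewrite mulgA mulgVK. Qed.

Lemma eqc_ctx k p x y q : eqc k x y -> eqc k (p * x * q) (p * y * q).
Proof.
by move/(prod_comm_conj p^-1); rewrite /eqc conjgE invgK !invgM !mulgA mulgK.
Qed.

Lemma eqc_pc k l x y : eqc k x y -> P l y -> P (k + l) x.
Proof. by move=> xy /(prod_comm_mul xy); rewrite mulgVK. Qed.

Lemma eqc_swap x q y : eqc 1 (x * q * y) (y * q * x).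
Proof.
rewrite /eqc; suff -> : x * q * y / (y * q * x) = [~ (x * q)^-1, (y / x)^-1] by exact: prod_comm_comm.
by rewrite commgEl conjgE !gnorm.
Qed.

Lemma pow_swap u v n : u * (v * u) ^+ n = (u * v) ^+ n * u.
Proof.
elim: n => [|n IHn]; first by rewrite !expg0 mulg1 mul1g.
by rewrite expgS [in RHS]expgS -!mulgA -IHn !mulgA.
Qed.

Lemma pow_split u v n : (u * v) ^+ n.+1 = u * (v * u) ^+ n * v.
Proof. by rewrite expgSr pow_swap !mulgA. Qed.

(** In [u * (v * (u * v) ^+ M * u) * v], which is [(u * v) ^+ (M + 2)], exchanging the inner [v] and
    [u] collects two letters [u] on the left and two [v] on the right. *)
Lemma eqc_gather u v j n :
  eqc j ((u * v) ^+ (n + j.*2)) (u ^+ j.*2 * (u * v) ^+ n * v ^+ j.*2).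
Proof.
elim: j => [|j IHj]; first by rewrite addn0 !expg0 mul1g mulg1; exact: eqc_refl.
rewrite -add1n; apply: (@eqc_trans (u * (u * (u * v) ^+ (n + j.*2) * v) * v)).
  have -> : (u * v) ^+ (n + (1 + j).*2) = u * (v * (u * v) ^+ (n + j.*2) * u) * v.
    rewrite add1n doubleS !addnS expgS expgSr !mulgA //.
  exact/eqc_ctx/eqc_swap.
have := eqc_ctx (u * u) (v * v) IHj; rewrite add1n doubleS 2!expgS 2!expgSr !mulgA.
by [].
Qed.

Lemma eqc_pow u v n : eqc n./2 ((u * v) ^+ n) (u ^+ n * v ^+ n).
Proof.
have := eqc_gather u v n./2 (odd n); rewrite odd_double_half.
suff -> : u ^+ n./2.*2 * (u * v) ^+ odd n * v ^+ n./2.*2 = u ^+ n * v ^+ n by [].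
rewrite -[in RHS](odd_double_half n); case: (odd n); last first.
  by rewrite expg0 mulg1 !add0n.
by rewrite expg1 add1n expgSr expgS !mulgA.
Qed.

(** For [N = 2m + 2] the gathered [u ^+ (N - 2)] is [u^-1 * u^-1]; one inverse cancels against the
    remaining power, and likewise for [v]. *)
Lemma eqc_even_step u v m M :
  u ^+ m.+1.*2 = 1 -> v ^+ m.+1.*2 = 1 ->
  eqc m ((u * v) ^+ (M + m.*2.+1)) (u^-1 * (v * u) ^+ M * v^-1).
Proof.
move=> uN vN; rewrite addnS -addSn.
have := eqc_gather u v m M.+1.
have -> : u ^+ m.*2 = u^-1 * u^-1.
  by apply: (mulgI (u * u)); rewrite mulgA mulgK mulgV -uN doubleS !expgS mulgA.
have -> : v ^+ m.*2 = v^-1 * v^-1.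
  by apply: (mulgI (v * v)); rewrite mulgA mulgK mulgV -vN doubleS !expgS mulgA.
by rewrite pow_split !gnorm.
Qed.

(** For [N = 2m + 1] the gathered powers are [u^-1] and [v^-1], which cancel the outer letters
    exactly. *)
Lemma eqc_odd_step u v m M :
  u ^+ m.*2.+1 = 1 -> v ^+ m.*2.+1 = 1 ->
  eqc m ((u * v) ^+ (M + m.*2.+1)) ((v * u) ^+ M).
Proof.
move=> uN vN; rewrite addnS -addSn.
have := eqc_gather u v m M.+1.
have -> : u ^+ m.*2 = u^-1.
  by apply: (mulgI u); rewrite mulgV -uN expgS.
have -> : v ^+ m.*2 = v^-1.
  by apply: (mulgI v); rewrite mulgV -vN expgS.
by rewrite pow_split !gnorm.
Qed.

(** For [N = 2m + 3] two periods are treated together: gathering [N - 3] letters leaves two inverses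
    on each side of a power of [v * u], from which [eqc_odd_step] removes [N]. The exponent falls by
    [2N - 1] in all. *)
Lemma eqc_odd_double_step u v m M :
  u ^+ m.+1.*2.+1 = 1 -> v ^+ m.+1.*2.+1 = 1 ->
  eqc (m + m.+1) ((u * v) ^+ (M + (m.*2.*2 + 5))) (u^-1 * (v * u) ^+ M * v^-1).
Proof.
move=> uN vN; have -> : (M + (m.*2.*2 + 5) = (M.+1 + m.+1.*2.+1).+1 + m.*2)%N by lia.
apply: (eqc_trans (eqc_gather u v m _)).
have -> : u ^+ m.*2 = u^-1 * u^-1 * u^-1.
  apply: (mulgI (u * u * u)); rewrite !mulgA !mulgK mulgV -uN doubleS !expgS !mulgA.
  by [].
have -> : v ^+ m.*2 = v^-1 * v^-1 * v^-1.
  apply: (mulgI (v * v * v)); rewrite !mulgA !mulgK mulgV -vN doubleS !expgS !mulgA.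
  by [].
have := eqc_ctx (u^-1 * u^-1) (v^-1 * v^-1) (eqc_odd_step M.+1 vN uN).
by rewrite [in X in _ -> X]pow_split pow_split !gnorm.
Qed.

(* Removing u ^+ N and v ^+ N from the power raises the twist i by one; the twist
   finally costs one commutator, because u * v and v * u are conjugate. *)
Definition twisted u v i M := (v * u) ^- i * (u * v) ^+ M.

Lemma prod_comm_twisted_step k c e u v i M :
  eqc c ((u * v) ^+ (M + e)) (u^-1 * (v * u) ^+ M * v^-1) ->
  P k (twisted v u i.+1 M) -> P (c + k) (twisted u v i (M + e)).
Proof.
move=> /(eqc_ctx ((v * u) ^- i) 1); rewrite !mulg1 => step Pk.
apply: (eqc_pc step); rewrite mulgA; apply: prod_comm_rot; move: Pk; rewrite /twisted.
suff -> : (u * v) ^- i.+1 = v^-1 * ((v * u) ^- i * u^-1) by rewrite !mulgA.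
by rewrite pow_split !invgM.
Qed.

(** Each step interchanges [u] and [v], so the parity of [s] decides which of the two final bounds
    is used. *)
Lemma prod_comm_twisted_chain c e s k i M u v :
  (forall M', eqc c ((u * v) ^+ (M' + e)) (u^-1 * (v * u) ^+ M' * v^-1)) ->
  (forall M', eqc c ((v * u) ^+ (M' + e)) (v^-1 * (u * v) ^+ M' * u^-1)) ->
  P k (twisted u v (i + s) M) -> P k (twisted v u (i + s) M) ->
  P (s * c + k) (twisted u v i (M + s * e)).
Proof.
elim: s i u v => [|s IHs] i u v uv vu; first by rewrite !addn0.
rewrite addnS -addSn => Puv Pvu; rewrite mulSn -addnA.
have -> : (M + s.+1 * e = M + s * e + e)%N by lia.
by apply: prod_comm_twisted_step => //; apply: IHs.
Qed.

(** * Powers of the product of [u] with a conjugate of its inverse *)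

Section Conjugate.
Variables (u v b : G).
Hypothesis v_conj : v = u^-1 ^ b.

(** As [v ^+ n] is the conjugate of [u ^- n] by [b], the product is the commutator of [b] and
    [u ^+ n]. *)
Lemma prod_comm_vu_pow n : P 1 (v ^+ n * u ^+ n).
Proof.
rewrite v_conj -conjXg expVgn -[u ^+ n as X in _ * X]/(u ^+ n) -commgEr.
exact: prod_comm_comm.
Qed.

Lemma prod_comm_uv_pow n : P n./2.+1 ((u * v) ^+ n).
Proof.
by rewrite -addn1; apply: (eqc_pc (eqc_pow u v n)); apply/prod_comm_rot/prod_comm_vu_pow.
Qed.

Lemma prod_comm_twisted_diag i : P 1 (twisted u v i i).
Proof.
rewrite /twisted; suff -> : (v * u) ^- i = (u * v) ^- i ^ u by rewrite -commgEr; exact: prod_comm_comm.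
by rewrite conjVg conjXg conjgE !mulgA mulVg mul1g.
Qed.

(** Exchanging [u] with [v * (u * v) ^+ q.+1] brings the latter next to the twist and cancels it. Up
    to conjugation [v * (v * u) ^+ r * u] remains, which gathers to the single commutator
    [v ^+ r.+1 * u ^+ r.+1]. *)
Lemma prod_comm_twisted q r : P (1 + (r./2 + 1)) (twisted u v q.+1 (q.+1 + r.+1)).
Proof.
have -> : twisted u v q.+1 (q.+1 + r.+1) =
    u^-1 * ((u * v) ^- q * v^-1 * (u * v) ^+ (q.+1 + r.+1)).
  rewrite /twisted !mulgA -!invgM; congr (_^-1 * _).
  by rewrite expgSr !mulgA -pow_swap -!mulgA.
apply: prod_comm_rot.
have -> : (u * v) ^+ (q.+1 + r.+1) = u * (v * u) ^+ r * (v * (u * v) ^+ q.+1).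
  by rewrite addnC expgnDr (pow_split u v r) !mulgA.
apply: (@eqc_pc 1 _ _ ((u * v) ^- q * v^-1 * (v * (u * v) ^+ q.+1 * (v * u) ^+ r * u) * u^-1)).
  apply: eqc_ctx; exact: eqc_swap.
rewrite expgSr !gnorm -mulgA; apply: prod_comm_rot.
apply: (eqc_pc (eqc_ctx v u (eqc_pow v u r))).
by have := prod_comm_vu_pow r.+1; rewrite expgS expgSr !mulgA.
Qed.

(** For positive [q] and [r], [prod_comm_twisted] is used with [r - 1]; rounding its half costs one
    more commutator when [r] is odd. *)
Lemma prod_comm_twisted_gen q r :
  P (r./2 + 1 + (odd r && (q != 0%N))) (twisted u v q (q + r)).
Proof.
case: q => [|q].
  by rewrite andbF addn0 addn1 add0n /twisted expg0 invg1 mul1g; apply: prod_comm_uv_pow.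
case: r => [|r]; first by rewrite addn0; apply: prod_comm_twisted_diag.
apply: prod_comm_leq (prod_comm_twisted q r); rewrite andbT /=.
by have := odd_double_half r; rewrite uphalf_half; case: (odd r) => /=; lia.
Qed.

End Conjugate.

Lemma prod_comm_pow_even u v b m q r :
  v = u^-1 ^ b -> u ^+ m.+1.*2 = 1 ->
  P (q * m + (r./2 + 1 + (odd r && (q != 0%N)))) ((u * v) ^+ (q * m.+1.*2 + r)).
Proof.
move=> vu uN; have uv : u = v^-1 ^ b^-1 by rewrite vu conjVg conjgK invgK.
have vN : v ^+ m.+1.*2 = 1 by rewrite vu -conjXg expVgn uN invg1 conj1g.
(* Each of the [q] steps lowers the exponent by [N - 1] and raises the twist by one, leaving
   exponent [q + r] and twist [q]. *)
have -> : (u * v) ^+ (q * m.+1.*2 + r) = twisted u v 0 ((q + r) + q * m.*2.+1).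
  by rewrite /twisted expg0 invg1 mul1g; congr (_ ^+ _); rewrite doubleS; lia.
apply: prod_comm_twisted_chain => [M|M||]; rewrite ?add0n.
- exact: eqc_even_step.
- exact: eqc_even_step.
- exact: (prod_comm_twisted_gen vu).
- exact: (prod_comm_twisted_gen uv).
Qed.

Lemma prod_comm_pow_odd_even u v b m s r :
  v = u^-1 ^ b -> u ^+ m.+1.*2.+1 = 1 ->
  P (s * (m + m.+1) + (r./2 + 1 + (odd r && (s != 0%N))))
    ((u * v) ^+ (s.*2 * m.+1.*2.+1 + r)).
Proof.
move=> vu uN; have uv : u = v^-1 ^ b^-1 by rewrite vu conjVg conjgK invgK.
have vN : v ^+ m.+1.*2.+1 = 1 by rewrite vu -conjXg expVgn uN invg1 conj1g.
have -> : (u * v) ^+ (s.*2 * m.+1.*2.+1 + r) =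
    twisted u v 0 ((s + r) + s * (m.*2.*2 + 5)).
  by rewrite /twisted expg0 invg1 mul1g; congr (_ ^+ _); rewrite doubleS -!muln2; lia.
apply: prod_comm_twisted_chain => [M|M||]; rewrite ?add0n.
- exact: eqc_odd_double_step.
- exact: eqc_odd_double_step.
- exact: (prod_comm_twisted_gen vu).
- exact: (prod_comm_twisted_gen uv).
Qed.

(** After [s] double steps one period is left; removing it by [eqc_odd_step] turns the base of the
    power into that of the twist, so the twist cancels without cost. *)
Lemma prod_comm_pow_odd_odd u v b m s r :
  v = u^-1 ^ b -> u ^+ m.+1.*2.+1 = 1 ->
  P (s * (m + m.+1) + (m.+1 + (r./2 + (r != 0%N))))
    ((u * v) ^+ (s.*2.+1 * m.+1.*2.+1 + r)).
Proof.
move=> vu uN; have uv : u = v^-1 ^ b^-1 by rewrite vu conjVg conjgK invgK.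
have vN : v ^+ m.+1.*2.+1 = 1 by rewrite vu -conjXg expVgn uN invg1 conj1g.
have finish x y c : y = x^-1 ^ c -> x ^+ m.+1.*2.+1 = 1 -> y ^+ m.+1.*2.+1 = 1 ->
  P (m.+1 + (r./2 + (r != 0%N))) (twisted x y s (s + r + m.+1.*2.+1)).
  move=> yx xN yN.
  apply: (@eqc_pc m.+1 _ _ ((y * x) ^- s * (y * x) ^+ (s + r))).
    have := eqc_ctx ((y * x) ^- s) 1 (eqc_odd_step (s + r) xN yN).
    by rewrite !mulg1.
  rewrite expgnDr mulKg; case: eqP => [->|_]; first exact: prod_comm1.
  rewrite addn1; apply: (@prod_comm_uv_pow y x c^-1).
  by rewrite yx conjVg conjgK invgK.
have -> : (u * v) ^+ (s.*2.+1 * m.+1.*2.+1 + r) =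
    twisted u v 0 ((s + r + m.+1.*2.+1) + s * (m.*2.*2 + 5)).
  by rewrite /twisted expg0 invg1 mul1g; congr (_ ^+ _); rewrite doubleS -!muln2; lia.
apply: prod_comm_twisted_chain => [M|M||]; rewrite ?add0n.
- exact: eqc_odd_double_step.
- exact: eqc_odd_double_step.
- exact: finish vu uN vN.
- exact: finish uv vN uN.
Qed.

(** In the dihedral group of the involutions [u] and [v], an odd power of [u * v] is [w * v] with
    [w] conjugate to [u]. Since [v] is conjugate to [u] as well, this is one commutator. *)
Lemma prod_comm_pow_involution u v b n :
  v = u^-1 ^ b -> u ^+ 2 = 1 -> odd n -> P 1 ((u * v) ^+ n).
Proof.
move=> vu u2 n_odd; have v2 : v ^+ 2 = 1 by rewrite vu -conjXg expVgn u2 invg1 conj1g.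
have uV : u^-1 = u by apply: (mulgI u); rewrite mulgV -u2 expg2.
have vV : v^-1 = v by apply: (mulgI v); rewrite mulgV -v2 expg2.
have XV i : (u * v) ^- i = (v * u) ^+ i by rewrite -expVgn invgM uV vV.
pose w := u ^ (u * v) ^- n./2; pose c := (u * v) ^+ n./2 * b.
suff -> : (u * v) ^+ n = [~ w^-1, c] by exact: prod_comm_comm.
have -> : [~ w^-1, c] = w * v.
  by rewrite commgEl invgK /c conjgM conjVg /w -conjgM mulVg conjg1 -vu.
have -> : w = (u * v) ^+ n./2 * (u * (v * u) ^+ n./2).
  by rewrite /w conjgE invgK XV.
rewrite -!mulgA [u * (_ * v)]mulgA -pow_split -expgnDr; congr (_ ^+ _).
by have := odd_double_half n; rewrite n_odd; lia.
Qed.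

(** The constructions are chosen by the parities of [N] and [n %/ N]; the condition [N = 2] with odd
    [n] is settled by the dihedral argument. *)
Lemma prod_comm_pow_commutator_gen u v b N n :
  v = u^-1 ^ b -> (1 < N)%N -> u ^+ N = 1 ->
  P (n %/ 2 - n %/ N + 2) ((u * v) ^+ n) /\
  ((~~ odd n /\ odd (n %/ N)) \/ (N %| n)%N \/ (n <= N)%N \/ N = 2%N ->
   P (n %/ 2 - n %/ N + 1) ((u * v) ^+ n)).
Proof.
move=> vu N1 uN; set q := (n %/ N)%N; set r := (n %% N)%N.
have en : n = (q * N + r)%N by exact: divn_eq.
have r0 : (N %| n)%N -> r = 0%N by rewrite /dvdn => /eqP.
have q0 : (n <= N)%N -> q = 0%N \/ r = 0%N.
  rewrite leq_eqVlt => /orP[/eqP nN|nN]; last by left; rewrite /q divn_small.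
  by right; rewrite /r nN modnn.
have rN : (r < N)%N by rewrite ltn_mod; lia.
have [k Pk kle] : exists2 k, P k ((u * v) ^+ n) &
   (k <= n %/ 2 - q + 2)%N /\
   ((~~ odd n /\ odd q) \/ r = 0%N \/ q = 0%N -> (k <= n %/ 2 - q + 1)%N).
  have [Nodd|Neven] := boolP (odd N); last first.
    have [m eN] : exists m, N = m.+1.*2.
      by exists (N./2.-1); have := odd_double_half N; rewrite (negbTE Neven); lia.
    move: uN; rewrite eN => uN; exists (q * m + (r./2 + 1 + (odd r && (q != 0%N))))%N.
      by rewrite en eN; exact: prod_comm_pow_even vu uN.
    have e2 : (n %/ 2 = q * m + q + r./2)%N.
      rewrite en eN divn2 -(half_bit_double (q * m + q + r./2) (odd r)).
      by rewrite -{1}(odd_double_half r) !doubleD -!muln2; congr _./2; lia.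
    rewrite e2; have on : odd n = odd r by rewrite en eN oddD oddM odd_double andbF.
    rewrite on; split; first by case: (odd r); case: (q != 0)%N; lia.
    move=> h; have -> : odd r && (q != 0%N) = false; last by lia.
    by case: h => [[/negbTE -> _]|[->|->]] //; rewrite andbF.
  have [m eN] : exists m, N = m.+1.*2.+1.
    by exists (N./2.-1); have := odd_double_half N; rewrite Nodd; lia.
  move: uN; rewrite eN => uN.
  have [qodd|qeven] := boolP (odd q); last first.
    have [s es] : exists s, q = s.*2.
      by exists q./2; have := odd_double_half q; rewrite (negbTE qeven).
    exists (s * (m + m.+1) + (r./2 + 1 + (odd r && (s != 0%N))))%N.
      by rewrite en eN es; exact: prod_comm_pow_odd_even vu uN.
    have e2 : (n %/ 2 = s * m.*2 + 3 * s + r./2)%N.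
      rewrite en eN es divn2 -(half_bit_double (s * m.*2 + 3 * s + r./2) (odd r)).
      by rewrite -{1}(odd_double_half r) !doubleD -!muln2; congr _./2; lia.
    have h1 : (s * (m + m.+1) = s * m.*2 + s)%N by rewrite -muln2; lia.
    rewrite e2 h1 es; split; first by case: (odd r && _); lia.
    move=> h; have -> : odd r && (s != 0%N) = false; last by lia.
    by case: h => [[_]|[->|/eqP]] //; rewrite ?odd_double // double_eq0 => /eqP ->; rewrite andbF.
  have [s es] : exists s, q = s.*2.+1.
    by exists q./2; have := odd_double_half q; rewrite qodd.
  exists (s * (m + m.+1) + (m.+1 + (r./2 + (r != 0%N))))%N.
    by rewrite en eN es; exact: prod_comm_pow_odd_odd vu uN.
  have e2 : (n %/ 2 = s * m.*2 + 3 * s + m.+1 + r./2 + odd r)%N.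
    rewrite en eN es divn2 -(half_bit_double (s * m.*2 + 3 * s + m.+1 + r./2 + odd r) (~~ odd r)).
    rewrite -{1}(odd_double_half r) !doubleD -!muln2; congr _./2; case: (odd r) => /=; lia.
  have h1 : (s * (m + m.+1) = s * m.*2 + s)%N by rewrite -muln2; lia.
  rewrite e2 h1 es; split; first by case: (odd r); case: (r != 0)%N; lia.
  have on : odd n = ~~ odd r by rewrite en eN es oddD oddM /= !odd_double.
  by rewrite on negbK; case=> [[-> _]|[->|//]] /=; lia.
split; first exact: prod_comm_leq kle.1 Pk.
case=> [[n2 q1]|[/r0 ?|[/q0 h|N2]]].
- by apply: prod_comm_leq Pk; apply: kle.2; left.
- by apply: prod_comm_leq Pk; apply: kle.2; right; left.
- by apply: prod_comm_leq Pk; apply: kle.2; case: h; tauto.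
have [n_odd|n_even] := boolP (odd n).
  by apply: (@prod_comm_leq 1); [lia|apply: (prod_comm_pow_involution vu) => //; rewrite -N2].
apply: prod_comm_leq Pk; apply: kle.2; right; left; apply: r0; rewrite N2 dvdn2.
exact: n_even.
Qed.

End CommutatorProducts.

(** * Coloured charts of surfaces *)

Section Colours.
Variable X : finType.
Implicit Types (Q : pred X) (f : X -> nat) (z y a b : X).

(* f takes at least m values on Q; counting classes of an invariant colouring avoids
   counting the cycles of permutations that are being modified. *)
Definition colours Q f m :=
  exists2 t : seq X, all Q t && uniq (map f t) & (m <= size t)%N.

Definition glue f a b x := if f x == f b then f a else f x.

(** The successor of the maximum is a colour not yet in use. *)
Definition recolour f z x := if x == z then (\max_y f y).+1 else f x.

Lemma recolour_fresh f z x : x != z -> recolour f z x != recolour f z z.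
Proof.
move=> /negbTE xz; rewrite /recolour xz eqxx ltn_eqF // ltnS.
exact: leq_bigmax.
Qed.

Lemma count_uniq_map f (t : seq X) c :
  uniq (map f t) -> (count (fun x => f x == c) t <= 1)%N.
Proof.
move=> /(count_uniq_mem c); rewrite count_map => ->; exact: leq_b1.
Qed.

Lemma colours_drop Q f m b :
  colours Q f m -> colours (fun x => Q x && (f x != f b)) f m.-1.
Proof.
move=> [t /andP[Qt ut] mt]; exists [seq x <- t | f x != f b].
  rewrite all_filter; apply/andP; split.
    by apply: sub_all Qt => x /= ->; apply/implyP.
  by apply: subseq_uniq ut; apply: map_subseq; exact: filter_subseq.
have := count_predC (fun x => f x == f b) t; have := count_uniq_map (f b) ut.
by rewrite size_filter -[count (predC _) t]/(count (fun x => f x != f b) t); lia.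
Qed.

Lemma colours_glue Q f m a b : colours Q f m -> colours Q (glue f a b) m.-1.
Proof.
move=> /(colours_drop b)[t /andP[Qt ut] mt]; exists t => //.
rewrite (sub_all _ Qt) /= => [|x /andP[] //].
rewrite (_ : map (glue f a b) t = map f t) //; apply/eq_in_map => x xt.
by rewrite /glue; have /andP[_ /negbTE ->] := allP Qt x xt.
Qed.

(** If the chosen representatives include [z], the point [y] of the same colour replaces it; then
    [z] is added with its fresh colour. *)
Lemma colours_recolour Q Q' f m z :
  (forall x, Q x -> Q' x) -> Q' z ->
  (Q z -> exists y, [/\ y != z, Q y & f y = f z]) ->
  colours Q f m -> colours Q' (recolour f z) m.+1.
Proof.
move=> QQ' Q'z Qz [t /andP[Qt ut] mt].
have fresh (t' : seq X) : z \notin t' -> all Q t' -> uniq (map f t') ->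
    size t = size t' -> colours Q' (recolour f z) m.+1.
  move=> zt' Qt' ut' st'; have nz x : x \in t' -> x != z.
    by apply: contraTneq => ->.
  exists (z :: t'); last by rewrite /= ltnS -st'.
  rewrite /= Q'z (sub_all QQ') //=; apply/andP; split.
    by apply/mapP => -[x /nz/(recolour_fresh f)/eqP /nesym].
  rewrite (_ : map (recolour f z) t' = map f t') //; apply/eq_in_map => x /nz.
  by rewrite /recolour => /negbTE ->.
have [zt|zt] := boolP (z \in t); last exact: (fresh t).
have [y [yz Qy fy]] := Qz (allP Qt z zt).
pose e x := if x == z then y else x; apply: (fresh (map e t)); last by rewrite size_map.
- apply/mapP => -[x _]; rewrite /e; case: eqP => [_ zy|xz zx].
    by move: yz; rewrite zy eqxx.
  exact: xz (esym zx).
- by rewrite all_map; apply: sub_all Qt => x Qx /=; rewrite /e; case: eqP.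
rewrite -map_comp (_ : map (f \o e) t = map f t) //; apply: eq_map => x /=.
by rewrite /e; case: eqP => [->|].
Qed.

End Colours.

Section Letters.
Variables (J : Type) (A : J -> groupType) (G : groupType).
Variable iota : forall j, {ghom A j -> G}.

Definition letter := {classic {j : J & A j}}.
Definition value (l : letter) : G := iota (tag l) (tagged l).

(** * Charts and their surgery *)

Section Charts.
Variable X : finType.
Implicit Types (s p : {perm X}) (lab : X -> letter) (x z : X).

(* At least m cycles of p have trivial product: a trivial product is recorded by a
   potential h increasing by the label of each letter. *)
Definition flat_colours p lab m :=
  exists Y : pred X, exists h : X -> G, exists f : X -> nat,
  [/\ forall x, Y (p x) = Y x, forall x, Y x -> f (p x) = f x,
      forall x, Y x -> h (p x) = h x * value (lab x) & colours Y f m].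

(* At least m cycles of s * p^-1, coloured by the corners they pass through. *)
Definition corner_colours s p m :=
  exists2 g : X -> nat, forall x, g (s x) = g (p x) & colours predT g m.

Lemma corner_tperm s p a b m :
  corner_colours s p m -> corner_colours (s * tperm a b) p m.-1.
Proof.
move=> [g g_sp /(colours_glue a b)]; exists (glue g a b) => // x.
by rewrite permM /glue -g_sp; case: tpermP => [->|->|//]; rewrite eqxx; case: eqP.
Qed.

Lemma corner_isolate s p y z m :
  p y = z -> corner_colours s p m -> corner_colours s (tperm y z * p) m.-1.
Proof.
move=> pyz [g g_sp /(colours_glue (p z) z)]; exists (glue g (p z) z) => // x.
by rewrite permM /glue g_sp; case: tpermP => [->|->|//]; rewrite pyz eqxx; case: eqP.
Qed.

(** As [g (s z) = g (p z) = g z], the old colour survives at [s z], while [z], now fixed by both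
    permutations, gets a fresh one. *)
Lemma corner_split s p z m :
  p z = z -> s z != z ->
  corner_colours s p m -> corner_colours (s * tperm z (s z)) p m.+1.
Proof.
move=> pz sz [g g_sp /(@colours_recolour _ _ predT _ _ z)] h.
exists (recolour g z); last first.
  by apply: h => // _; exists (s z); split=> //; rewrite g_sp pz.
move=> x; rewrite permM; case: tpermP => [e|e|/eqP sxz /eqP sxs].
- have xz : x != z by apply: contraNneq sz => xz; rewrite -{1}xz e.
  have pxz : p x != z by apply: contraNneq xz => /(canRL (permK p)) ->; rewrite -{1}pz permK.
  by rewrite /recolour (negbTE sz) (negbTE pxz) -g_sp e g_sp pz.
- by rewrite (perm_inj e) pz.
have xz : x != z by apply: contraNneq sxs => ->.
have pxz : p x != z by apply: contraNneq xz => /(canRL (permK p)) ->; rewrite -{1}pz permK.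
by rewrite /recolour (negbTE sxz) (negbTE pxz).
Qed.

(** The new permutation agrees with [s] at [x], so the corner [s x] can be coloured separately; its
    old colour survives at [p x]. *)
Lemma corner_join s p x y m :
  p y = s x -> x != y ->
  corner_colours s p m -> corner_colours s (tperm x y * p) m.+1.
Proof.
move=> pys xy [g g_sp /(@colours_recolour _ _ predT _ _ (s x))] h.
have pxs : p x != s x by rewrite -pys (inj_eq perm_inj).
exists (recolour g (s x)); last first.
  by apply: h => // _; exists (p x); split=> //.
move=> t; rewrite permM; case: tpermP => [->|->|/eqP tx /eqP ty].
- by rewrite pys.
- have syx : s y != s x by rewrite (inj_eq perm_inj) eq_sym.
  by rewrite /recolour (negbTE syx) (negbTE pxs) g_sp pys g_sp.
have stx : s t != s x by rewrite (inj_eq perm_inj).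
have pts : p t != s x by rewrite -pys (inj_eq perm_inj).
by rewrite /recolour (negbTE stx) (negbTE pts).
Qed.

Lemma flat_isolate p lab y z m :
  p y = z -> y != z -> value (lab z) = 1 ->
  flat_colours p lab m -> flat_colours (tperm y z * p) lab m.+1.
Proof.
move=> pyz yz lz [Y [h [f [Yp fp hp cf]]]].
exists (fun x => Y x || (x == z)), h, (recolour f z).
have ptz t : t != y -> p t != z.
  by apply: contraNneq => e; rewrite -(inj_eq (@perm_inj _ p)) pyz e.
have pz : p z != z by rewrite ptz // eq_sym.
have Yyz : Y y = Y z by rewrite -Yp pyz.
have fyz : Y y -> f z = f y by move=> Yy; rewrite -(fp y) // pyz.
have hyz : Y y -> h z = h y * value (lab y) by move=> Yy; rewrite -hp // pyz.
split.
- move=> x; rewrite permM; case: tpermP => [->|->|/eqP xy /eqP xz].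
  + by rewrite (negbTE pz) (negbTE yz) !orbF Yp.
  + by rewrite pyz.
  by rewrite Yp (negbTE xz) (negbTE (ptz _ xy)).
- move=> x; rewrite permM; case: tpermP => [->|->|/eqP xy /eqP xz].
  + rewrite (negbTE yz) orbF /recolour (negbTE pz) (negbTE yz) => Yy.
    by rewrite fp -?Yyz // fyz.
  + by rewrite pyz.
  rewrite (negbTE xz) orbF /recolour (negbTE xz) (negbTE (ptz _ xy)).
  exact: fp.
- move=> x; rewrite permM; case: tpermP => [->|->|/eqP xy /eqP xz].
  + rewrite (negbTE yz) orbF => Yy.
    by rewrite hp -?Yyz // lz mulg1 hyz.
  + by rewrite pyz lz mulg1.
  by rewrite (negbTE xz) orbF; exact: hp.
apply: colours_recolour cf => [x ->||Yz] //; first by rewrite eqxx orbT.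
by exists y; split; rewrite ?Yyz // fyz // Yyz.
Qed.

(** When [x] and [y] have different flat colours, shifting the potential on one colour makes the
    joined part flat. In all other cases one colour is given up. *)
Lemma flat_join p lab x y m :
  x != y -> flat_colours p lab m -> flat_colours (tperm x y * p) lab m.-1.
Proof.
move=> xy [Y [h [f [Yp fp hp cf]]]].
have drop b (dx : Y x -> f x = f b) (dy : Y y -> f y = f b) :
    flat_colours (tperm x y * p) lab m.-1.
  exists (fun t => Y t && (f t != f b)), h, f; split.
  - move=> t; rewrite permM; case: tpermP => [->|->|_ _]; rewrite Yp.
    + case: (boolP (Y y)) => Yy /=; last first.
        by case: (boolP (Y x)) => //= /dx ->; rewrite eqxx.
      rewrite fp // dy // eqxx /=.
      by case: (boolP (Y x)) => //= /dx ->; rewrite eqxx.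
    + case: (boolP (Y x)) => Yx /=; last first.
        by case: (boolP (Y y)) => //= /dy ->; rewrite eqxx.
      rewrite fp // dx // eqxx /=.
      by case: (boolP (Y y)) => //= /dy ->; rewrite eqxx.
    by case: (boolP (Y t)) => //= Yt; rewrite fp.
  - move=> t /andP[Yt ftb]; rewrite permM; case: tpermP => [e|e|_ _]; last exact: fp.
      by case/eqP: ftb; rewrite e dx -?e.
    by case/eqP: ftb; rewrite e dy -?e.
  - move=> t /andP[Yt ftb]; rewrite permM; case: tpermP => [e|e|_ _]; last exact: hp.
      by case/eqP: ftb; rewrite e dx -?e.
    by case/eqP: ftb; rewrite e dy -?e.
  exact: colours_drop.
have [Yx|nYx] := boolP (Y x); last by apply: (drop y) => // Yx; rewrite Yx in nYx.
have [Yy|nYy] := boolP (Y y); last by apply: (drop x) => // Yy; rewrite Yy in nYy.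
have [fxy|fxy] := eqVneq (f x) (f y); first exact: (drop y).
(* This shift makes the potential just after [y] agree with the one just after [x]. *)
pose c := h x * value (lab x) / (h y * value (lab y)).
exists Y, (fun t => if f t == f y then c * h t else h t), (glue f x y); split.
- by move=> t; rewrite permM; case: tpermP => [->|->|_ _]; rewrite !Yp // Yx Yy.
- move=> t Yt; rewrite permM /glue; case: tpermP => [->|->|_ _]; rewrite fp ?eqxx //.
    by rewrite (negbTE fxy).
  by rewrite (negbTE fxy).
- move=> t Yt; rewrite permM; case: tpermP => [->|->|_ _]; rewrite fp ?hp //.
  + by rewrite eqxx (negbTE fxy) /c mulgVK.
  + by rewrite eqxx (negbTE fxy) /c -mulgA mulgVK.
  by case: eqP; rewrite ?mulgA.
exact: colours_glue.
Qed.

(** Only the potential between the two letters, at [p x], has to change. *)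
Lemma flat_slide p lab lab' x m :
  p x != x -> (forall t, t != x -> t != p x -> lab' t = lab t) ->
  value (lab' x) * value (lab' (p x)) = value (lab x) * value (lab (p x)) ->
  flat_colours p lab m -> flat_colours p lab' m.
Proof.
move=> pxx labE valE [Y [h [f [Yp fp hp cf]]]].
exists Y, (fun t => if t == p x then h x * value (lab' x) else h t), f; split=> // t Yt.
have [->|tx] := eqVneq t x; first by rewrite eqxx eq_sym (negbTE pxx).
rewrite (inj_eq perm_inj) (negbTE tx); have [e|tpx] := eqVneq t (p x).
  have Yx : Y x by rewrite -Yp -e.
  by rewrite hp // e -mulgA valE mulgA hp.
by rewrite labE // hp.
Qed.

(* A surface with boundary words cs: its Euler characteristic F + K - #|X| is at least
   size cs - d, so d bounds twice the genus when there is one boundary. *)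
Definition chart_on s p lab (cs : seq (seq X)) d :=
  [/\ uniq (flatten cs), forall x, x \in flatten cs,
      forall c, c \in cs -> map s c = rot 1 c,
      forall x, tag (lab (p x)) = tag (lab x) &
      exists F K, [/\ flat_colours p lab F, corner_colours s p K &
                      (#|X| + size cs <= F + K + d)%N]].

Lemma chart_rot s p lab u v cs d :
  chart_on s p lab ((u ++ v) :: cs) d -> chart_on s p lab ((v ++ u) :: cs) d.
Proof.
move=> [uX allX sX pX cX].
have pe : perm_eq (flatten ((v ++ u) :: cs)) (flatten ((u ++ v) :: cs)).
  by rewrite /= perm_cat2r perm_catC.
split=> //; first by rewrite (perm_uniq pe).
  by move=> x; rewrite (perm_mem pe).
move=> c; rewrite inE => /predU1P[->|ccs]; last by apply: sX; rewrite inE ccs orbT.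
rewrite -(rot_size_cat u v) map_rot sX ?mem_head //.
by rewrite rot_rot.
Qed.

Lemma map_tperm_id x y (l : seq X) :
  x \notin l -> y \notin l -> map (tperm x y) l = l.
Proof.
move=> xl yl; rewrite -[RHS]map_id; apply/eq_in_map => t tl /=.
by rewrite tpermD //; [apply: contraNneq xl | apply: contraNneq yl] => ->.
Qed.

Lemma uniq_heads x u y v (t : seq (seq X)) :
  uniq (flatten ((x :: u) :: (y :: v) :: t)) ->
  [/\ x \notin u, x \notin v & x \notin flatten t] /\
  [/\ y \notin u, y \notin v & y \notin flatten t].
Proof.
have pe : perm_eq (flatten ((x :: u) :: (y :: v) :: t)) (x :: y :: (u ++ v ++ flatten t)).
  by rewrite /= perm_cons (perm_catCA u [:: y]).
rewrite (perm_uniq pe) /= inE !mem_cat !negb_or.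
by case/and3P => /and4P[_ xu xv xt] /and3P[yu yv yt] _.
Qed.

(** At most one corner colour is lost, together with one boundary, so [d] is kept. *)
Lemma chart_merge s p lab u v cs d :
  u != [::] -> v != [::] ->
  chart_on s p lab (u :: v :: cs) d ->
  exists s', chart_on s' p lab ((u ++ v) :: cs) d.
Proof.
case: u v => [|x u] [|y v] // _ _ [uX allX sX pX [F [K [fF cK cnt]]]].
have fE : flatten (((x :: u) ++ y :: v) :: cs) = flatten ((x :: u) :: (y :: v) :: cs).
  by rewrite /= -catA.
exists (s * tperm x y); split; rewrite ?fE //.
- have su := sX (x :: u) (mem_head _ _).
  have sv := sX (y :: v); rewrite !inE eqxx orbT in sv; have {}sv := sv isT.
  have sE l : map (s * tperm x y) l = map (tperm x y) (map s l).
    by rewrite -map_comp; apply: eq_map => t; rewrite /= permM.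
  have [[xu xv xcs] [yu yv ycs]] := uniq_heads uX.
  move=> c; rewrite inE => /predU1P[->|ccs].
    rewrite sE map_cat su sv !rot1_cons map_cat.
    rewrite !map_rcons !map_tperm_id // tpermL tpermR.
    by rewrite -!cats1 -!catA.
  rewrite sE sX ?map_rot ?map_tperm_id //; last by rewrite !inE ccs !orbT.
    by apply: contra xcs => xc; apply/flattenP; exists c.
  by apply: contra ycs => yc; apply/flattenP; exists c.
exists F, K.-1; split=> //; first exact: corner_tperm.
by move: cnt => /=; lia.
Qed.

Lemma cut_cycle s x u y v cs :
  uniq (flatten ((x :: u) :: (y :: v) :: cs)) ->
  (forall c, c \in ((x :: u) ++ y :: v) :: cs -> map s c = rot 1 c) ->
  forall c, c \in (x :: u) :: (y :: v) :: cs -> map (s * tperm x y) c = rot 1 c.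
Proof.
move=> uX sX; have [[xu xv xcs] [yu yv ycs]] := uniq_heads uX.
have sE l : map (s * tperm x y) l = map (tperm x y) (map s l).
  by rewrite -map_comp; apply: eq_map => t; rewrite /= permM.
have := sX _ (mem_head _ _); rewrite map_cat rot1_cons.
rewrite -[rcons _ x]cats1 -catA cats1 rcons_cons -(cat_rcons y u) => /eqP.
rewrite eqseq_cat ?size_map ?size_rcons // => /andP[/eqP su /eqP sv] c.
rewrite inE => /predU1P[->|].
  by rewrite sE su map_rcons map_tperm_id // tpermR rot1_cons.
rewrite inE => /predU1P[->|ccs].
  by rewrite sE -cats1 in sv *; rewrite sv map_cat map_tperm_id //= tpermL cats1 rot1_cons.
rewrite sE sX ?map_rot ?map_tperm_id //; last by rewrite inE ccs orbT.
  by apply: contra xcs => xc; apply/flattenP; exists c.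
by apply: contra ycs => yc; apply/flattenP; exists c.
Qed.

(** A corner colour may be lost while a boundary is added; hence [d] grows by two. *)
Lemma chart_split s p lab u v cs d :
  u != [::] -> v != [::] ->
  chart_on s p lab ((u ++ v) :: cs) d ->
  exists s', chart_on s' p lab (u :: v :: cs) d.+2.
Proof.
case: u v => [|x u] [|y v] // _ _ [uX allX sX pX [F [K [fF cK cnt]]]].
have fE : flatten ((x :: u) :: (y :: v) :: cs) = flatten (((x :: u) ++ y :: v) :: cs).
  by rewrite /= -catA.
exists (s * tperm x y); split; rewrite ?fE //; first by apply: cut_cycle; rewrite ?fE.
exists F, K.-1; split=> //; first exact: corner_tperm.
by move: cnt => /=; lia.
Qed.

(* Removing a trivial letter from its cycle of p creates a new flat cycle. *)
Lemma chart_isolate s p lab z cs d :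
  value (lab z) = 1 -> chart_on s p lab cs d ->
  exists2 p' : {perm X}, p' z = z & chart_on s p' lab cs d.
Proof.
move=> lz ch; have [pz|pz] := eqVneq (p z) z; first by exists p.
case: ch => uX allX sX pX [F [K [fF cK cnt]]].
have py : p (p^-1 z) = z by rewrite permKV.
have yz : p^-1 z != z by rewrite -(inj_eq (@perm_inj _ p)) py eq_sym.
exists (tperm (p^-1 z) z * p); first by rewrite permM tpermR.
split=> //; first by move=> x; rewrite permM pX; case: tpermP => // ->; rewrite -(pX (p^-1 z)) py.
exists F.+1, K.-1; split; [exact: flat_isolate | exact: corner_isolate | by lia].
Qed.

(** The surgery may lose a flat colour but gains a corner colour; equal tags keep each cycle of [p]
    inside one factor. *)
Lemma chart_join s p lab x cs d :
  tag (lab (s x)) = tag (lab x) -> chart_on s p lab cs d ->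
  exists2 p' : {perm X}, p' x = s x & chart_on s p' lab cs d.
Proof.
move=> tx ch; have [px|px] := eqVneq (p x) (s x); first by exists p.
case: ch => uX allX sX pX [F [K [fF cK cnt]]].
have py : p (p^-1 (s x)) = s x by rewrite permKV.
have yx : x != p^-1 (s x) by rewrite -(inj_eq (@perm_inj _ p)) py.
exists (tperm x (p^-1 (s x)) * p); first by rewrite permM tpermL.
split=> //.
  move=> t; rewrite permM pX; case: tpermP => // ->; by rewrite -(pX (p^-1 (s x))) py tx.
exists F.-1, K.+1; split; [exact: flat_join | exact: corner_join | by lia].
Qed.

Lemma chart_slide s p lab lab' x cs d :
  s x != x -> (forall t, t != x -> t != s x -> lab' t = lab t) ->
  (forall t, tag (lab' t) = tag (lab t)) -> tag (lab (s x)) = tag (lab x) ->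
  value (lab' x) * value (lab' (s x)) = value (lab x) * value (lab (s x)) ->
  chart_on s p lab cs d -> exists p', chart_on s p' lab' cs d.
Proof.
move=> sx labE tagE tx valE /(chart_join tx)[p' px [uX allX sX pX [F [K [fF cK cnt]]]]].
exists p'; split=> //; first by move=> t; rewrite !tagE.
exists F, K; split=> //; by apply: (@flat_slide p' lab lab' x) fF; rewrite px.
Qed.

(** Once [z] is fixed by [p], cutting it off creates a corner colour, which pays for the new
    boundary. *)
Lemma chart_cut s p lab z w cs d :
  value (lab z) = 1 -> w != [::] -> chart_on s p lab ((z :: w) :: cs) d ->
  exists s', exists2 p' : {perm X}, p' z = z & chart_on s' p' lab ([:: z] :: w :: cs) d.
Proof.
case: w => // y w lz _ /(chart_isolate lz)[p' pz [uX allX sX pX [F [K [fF cK cnt]]]]].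
have sz : s z = y.
  by have := sX _ (mem_head _ _); rewrite rot1_cons /= => -[].
have yz : y != z.
  by move: uX => /= /andP[]; rewrite inE negb_or eq_sym => /andP[].
exists (s * tperm z y), p' => //; split=> //.
  by apply: cut_cycle.
exists F, K.+1; split=> //; last by move: cnt => /=; lia.
by rewrite -sz; apply: corner_split; rewrite // sz.
Qed.

End Charts.

(** * Boundary words of charts: inserting, deleting and sliding letters *)

Definition bounds (ws : seq (seq letter)) d :=
  exists (X : finType) (lab : X -> letter) (cs : seq (seq X)) (s p : {perm X}),
    ws = map (map lab) cs /\ chart_on s p lab cs d.

Section AddPoint.
Variable X : finType.

Definition option_perm_fun (p : {perm X}) (o : option X) := omap p o.

Lemma option_perm_inj p : injective (option_perm_fun p).
Proof. by move=> [x|] [y|] //= [/perm_inj ->]. Qed.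

Definition option_perm p := perm (@option_perm_inj p).

(** The new point is a disc: one letter and one boundary against one flat cycle and one corner. *)
Lemma chart_add (s p : {perm X}) lab l (cs : seq (seq X)) d :
  value l = 1 -> chart_on s p lab cs d ->
  chart_on (option_perm s) (option_perm p) (oapp lab l)
    ([:: None] :: map (map some) cs) d.
Proof.
move=> vl [uX allX sX pX [F [K [fF cK cnt]]]].
have fE : flatten (map (map some) cs) = map some (flatten cs) by rewrite map_flatten.
split.
- rewrite /= fE map_inj_uniq ?uX ?andbT; last by move=> ? ? [].
  by apply/mapP => -[].
- by case=> [x|]; rewrite //= inE /= fE mem_map // => ? ? [].
- move=> c; rewrite inE => /predU1P[->|/mapP[c' c'cs ->]].
    by rewrite /= permE.
  rewrite -map_rot -sX // -!map_comp; apply: eq_map => x /=; by rewrite permE.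
- by case=> [x|]; rewrite permE //=.
exists F.+1, K.+1; split; last by rewrite card_option /= size_map !addSn !addnS !addSn !ltnS.
  case: fF => Y [h [f [Yp fp hp [t /andP[Yt ut] Ft]]]].
  exists (fun o => if o is Some x then Y x else true), (fun o => if o is Some x then h x else 1).
  exists (fun o => if o is Some x then (f x).+1 else 0%N); split.
  - by case=> [x|]; rewrite permE /=.
  - by case=> [x|]; rewrite permE //= => Yx; rewrite fp.
  - by case=> [x|]; rewrite permE /= ?vl ?mulg1 // => Yx; rewrite hp.
  exists (None :: map some t); last by rewrite /= size_map.
  rewrite /= all_map Yt -map_comp /=; apply/andP; split; first by apply/mapP => -[].
  by rewrite (map_comp S f) map_inj_uniq // => ? ? [].
case: cK => g g_sp [t /andP[_ ut] Kt].
exists (fun o => if o is Some x then (g x).+1 else 0%N).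
  by case=> [x|]; rewrite !permE //= g_sp.
exists (None :: map some t); last by rewrite /= size_map.
rewrite /= all_predT -map_comp /=; apply/andP; split; first by apply/mapP => -[].
by rewrite (map_comp S g) map_inj_uniq // => ? ? [].
Qed.

End AddPoint.

Section RemovePoint.
Variables (X : finType) (z : X).
Let X' := {x | x != z}.

Lemma sub_perm_proof (p : {perm X}) : p z = z -> forall x : X', p (val x) != z.
Proof.
move=> pz x; apply: contra (valP x) => /eqP pxz.
by rewrite -(inj_eq (@perm_inj _ p)) pz pxz.
Qed.

Lemma sub_perm_inj (p : {perm X}) (pz : p z = z) :
  injective (fun x : X' => exist (fun x => x != z) _ (sub_perm_proof pz x)).
Proof. by move=> x y /(congr1 val) /= /perm_inj /val_inj. Qed.

Definition sub_perm (p : {perm X}) (pz : p z = z) : {perm X'} := perm (@sub_perm_inj p pz).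

Lemma val_sub_perm (p : {perm X}) (pz : p z = z) x : val (sub_perm pz x) = p (val x).
Proof. by rewrite permE. Qed.

Lemma colours_remove Q (f : X -> nat) m :
  colours Q f m -> colours (fun x : X' => Q (val x)) (fun x : X' => f (val x)) m.-1.
Proof.
move=> /(colours_drop z)[t /andP[Qt ut] mt].
have t_z : all (fun x => x != z) t.
  by apply: sub_all Qt => x /andP[_]; apply: contraNneq => ->.
have tE : map val (pmap insub t : seq X') = t.
  by rewrite (pmap_filter (insubK _)); apply/all_filterP; apply: sub_all t_z => x; rewrite isSome_insub.
exists (pmap insub t); last by rewrite -[X in (_ <= X)%N](size_map val) tE.
rewrite -{1}tE all_map in Qt; rewrite (sub_all _ Qt) /=; last by move=> x /andP[].
by rewrite (map_comp f val) tE.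
Qed.

Lemma chart_remove (s p : {perm X}) lab cs d :
  p z = z -> chart_on s p lab ([:: z] :: cs) d -> bounds (map (map lab) cs) d.
Proof.
move=> pz [uX allX sX pX [F [K [fF cK cnt]]]].
have sz : s z = z by have := sX _ (mem_head _ _); rewrite rot1_cons /= => -[].
have zcs : z \notin flatten cs by move: uX => /= /andP[].
pose cs' : seq (seq X') := map (pmap insub) cs.
have csE : map (map val) cs' = cs.
  rewrite -map_comp -[RHS]map_id; apply/eq_in_map => c ccs /=.
  rewrite (pmap_filter (insubK _)); apply/all_filterP/allP => x xc.
  by rewrite isSome_insub; apply: contraNneq zcs => <-; apply/flattenP; exists c.
have fcsE : map val (flatten cs') = flatten cs by rewrite map_flatten csE.
exists X', (lab \o val), cs', (sub_perm sz), (sub_perm pz); split.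
  by rewrite -[in LHS]csE -map_comp; apply: eq_map => c /=; rewrite -map_comp.
split.
- by rewrite -(map_inj_uniq val_inj) fcsE; move: uX => /= /andP[].
- move=> x; rewrite -(mem_map val_inj) fcsE; have := allX (val x).
  by rewrite /= inE (negbTE (valP x)).
- move=> c ccs; apply: (inj_map val_inj); rewrite map_rot -sX.
    by rewrite -!map_comp; apply: eq_map => x /=; rewrite val_sub_perm.
  by rewrite inE -[cs]csE map_f ?orbT.
- by move=> x /=; rewrite val_sub_perm.
have cX : #|X| = #|{: X'}|.+1.
  rewrite (cardD1 z X) card_sig inE add1n; congr _.+1.
  by apply: eq_card => x; rewrite !inE andbT.
exists F.-1, K.-1; split.
- case: fF => Y [h [f [Yp fp hp cf]]].
  exists (fun x : X' => Y (val x)), (fun x : X' => h (val x)), (fun x : X' => f (val x)).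
  split; try by move=> x; rewrite val_sub_perm //; auto.
  exact: colours_remove.
- case: cK => g g_sp cg; exists (fun x : X' => g (val x)); last exact: (colours_remove cg).
  by move=> x; rewrite !val_sub_perm.
by move: cnt; rewrite cX /= size_map addSn addnS; move: (_ + size _)%N => n; lia.
Qed.

End RemovePoint.

Lemma map_eq_cat (T S : Type) (f : T -> S) c u v :
  u ++ v = map f c -> exists a b, [/\ c = a ++ b, map f a = u & map f b = v].
Proof.
move=> e; exists (take (size u) c), (drop (size u) c).
by rewrite cat_take_drop map_take map_drop -e take_size_cat ?drop_size_cat.
Qed.

Lemma bounds_rot u v ws d : bounds ((u ++ v) :: ws) d -> bounds ((v ++ u) :: ws) d.
Proof.
move=> [X [lab [[|c cs] [s [p [//= [/map_eq_cat[a [b [-> <- <-]]] ->] ch]]]]]].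
exists X, lab, ((b ++ a) :: cs), s, p; split; first by rewrite /= map_cat.
exact: chart_rot.
Qed.

Lemma bounds_merge u v ws d : u != [::] -> v != [::] ->
  bounds (u :: v :: ws) d -> bounds ((u ++ v) :: ws) d.
Proof.
move=> u0 v0 [X [lab [[|a [|b cs]] [s [p [//= [ua vb ->] ch]]]]]].
have a0 : a != [::] by apply: contraNneq u0; rewrite ua => ->.
have b0 : b != [::] by apply: contraNneq v0; rewrite vb => ->.
have [s' ch'] := chart_merge a0 b0 ch.
by exists X, lab, ((a ++ b) :: cs), s', p; rewrite /= map_cat -ua -vb.
Qed.

Lemma bounds_split u v ws d : u != [::] -> v != [::] ->
  bounds ((u ++ v) :: ws) d -> bounds (u :: v :: ws) d.+2.
Proof.
move=> u0 v0 [X [lab [[|c cs] [s [p [//= [/map_eq_cat[a [b [-> ua vb]]] ->] ch]]]]]].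
have a0 : a != [::] by apply: contraNneq u0; rewrite -ua => ->.
have b0 : b != [::] by apply: contraNneq v0; rewrite -vb => ->.
have [s' ch'] := chart_split a0 b0 ch.
by exists X, lab, (a :: b :: cs), s', p; rewrite /= ua vb.
Qed.

Lemma bounds_ins l w ws d : value l = 1 -> w != [::] ->
  bounds (w :: ws) d -> bounds ((l :: w) :: ws) d.
Proof.
move=> vl w0 [X [lab [cs [s [p [wsE ch]]]]]].
apply: (@bounds_merge [:: l]) => //.
exists (option X), (oapp lab l), ([:: None] :: map (map some) cs), (option_perm s), (option_perm p).
split; last exact: chart_add.
by rewrite wsE /= -map_comp; congr (_ :: _); apply: eq_map => c /=; rewrite -map_comp.
Qed.

Lemma bounds_del l w ws d : value l = 1 -> w != [::] ->
  bounds ((l :: w) :: ws) d -> bounds (w :: ws) d.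
Proof.
move=> vl w0 [X [lab [[|[|z c] cs] [s [p [//= [lz wc ->] ch]]]]]].
have c0 : c != [::] by apply: contraNneq w0; rewrite wc => ->.
have vz : value (lab z) = 1 by rewrite -lz.
have [s' [p' pz ch']] := chart_cut vz c0 ch.
by rewrite wc; exact: chart_remove pz ch'.
Qed.

Lemma bounds_slide l1 l2 l1' l2' w ws d :
  tag l1' = tag l1 -> tag l2 = tag l1 -> tag l2' = tag l2 ->
  value l1' * value l2' = value l1 * value l2 ->
  bounds ((l1 :: l2 :: w) :: ws) d -> bounds ((l1' :: l2' :: w) :: ws) d.
Proof.
move=> t1 t12 t2 vE [X [lab [[|[|x [|y c]] cs] [s [p [//= [lx ly wc ->] ch]]]]]].
have [uX allX sX _ _] := ch.
have sx : s x = y by have := sX _ (mem_head _ _); rewrite rot1_cons /= => -[].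
have [xy [xc yc] [xcs ycs]] :
    [/\ y != x, (x \notin c) /\ (y \notin c) & (x \notin flatten cs) /\ (y \notin flatten cs)].
  move: uX; rewrite /= inE !mem_cat !negb_or [x == y]eq_sym.
  by case/and3P => /and3P[-> -> ->] /andP[-> ->].
pose lab' t := if t == x then l1' else if t == y then l2' else lab t.
have labE t : t != x -> t != y -> lab' t = lab t.
  by rewrite /lab' => /negbTE -> /negbTE ->.
have [p' ch'] : exists p', chart_on s p' lab' ((x :: y :: c) :: cs) d.
  apply: (@chart_slide _ s p lab lab' x) ch; rewrite ?sx //.
  - move=> t; rewrite /lab'; case: eqP => [->|_]; first by rewrite t1 lx.
    by case: eqP => [->|_] //; rewrite t2 ly.
  - by rewrite -lx -ly.
  by rewrite /lab' !eqxx (negbTE xy) -lx -ly.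
exists X, lab', ((x :: y :: c) :: cs), s, p'; split=> //=.
have nE (t : seq X) : x \notin t -> y \notin t -> map lab t = map lab' t.
  move=> xt yt; apply/eq_in_map => z zt; rewrite labE //.
    by apply: contraNneq xt => <-.
  by apply: contraNneq yt => <-.
rewrite {1 2}/lab' !eqxx (negbTE xy) wc -nE //; congr (_ :: _).
apply/eq_in_map => t tcs; apply: nE; [move: xcs|move: ycs]; apply: contra => h.
  by apply/flattenP; exists t.
by apply/flattenP; exists t.
Qed.

Lemma bounds_trivial l : value l = 1 -> bounds [:: [:: l]] 0.
Proof.
move=> vl; exists unit, (fun=> l), [:: [:: tt]], 1, 1; split=> //; split=> //.
  by move=> c; rewrite inE => /eqP ->; rewrite /= perm1.
exists 1%N, 1%N; split; last by rewrite card_unit.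
  exists predT, (fun=> 1), (fun=> 0%N); split=> // [_ _|]; first by rewrite vl mulg1.
  by exists [:: tt].
by exists (fun=> 0%N) => //; exists [:: tt].
Qed.

(* Equality in the free product, generated by moves that preserve [bounds]. *)
Inductive eqv : seq letter -> seq letter -> Prop :=
| eqv_refl u : eqv u u
| eqv_trans u v w : eqv u v -> eqv v w -> eqv u w
| eqv_ins p l q : value l = 1 -> eqv (p ++ q) (p ++ l :: q)
| eqv_del p l q : value l = 1 -> eqv (p ++ l :: q) (p ++ q)
| eqv_slide p l1 l2 l1' l2' q :
    tag l1' = tag l1 -> tag l2 = tag l1 -> tag l2' = tag l2 ->
    value l1' * value l2' = value l1 * value l2 ->
    eqv (p ++ l1 :: l2 :: q) (p ++ l1' :: l2' :: q).

(** Rotations bring the changed letters to the front; the untouched [w] keeps the boundary word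
    nonempty. *)
Lemma bounds_eqv u v w ws d : eqv u v -> w != [::] ->
  bounds ((u ++ w) :: ws) d -> bounds ((v ++ w) :: ws) d.
Proof.
move=> uv w0; elim: uv => {u v} // [u v t _ IHu _ IHv|p l q vl|p l q vl|].
- by move/IHu/IHv.
- rewrite -!catA => /bounds_rot; rewrite -catA => h; apply: bounds_rot.
  rewrite /= -catA; apply: bounds_ins => //.
  by case: q w w0 {h} => [|? ?] [|? ?].
- rewrite -!catA => /bounds_rot; rewrite /= -catA => h; apply: bounds_rot.
  rewrite -catA; apply: bounds_del h => //.
  by case: q w w0 => [|? ?] [|? ?].
move=> p l1 l2 l1' l2' q t1 t12 t2 vE; rewrite -!catA => /bounds_rot /= h.
by apply: bounds_rot => /=; apply: bounds_slide h.
Qed.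

Lemma eqv_sym u v : eqv u v -> eqv v u.
Proof.
elim=> {u v} [u|u v w _ vu _ wv|p l q vl|p l q vl|p l1 l2 l1' l2' q t1 t12 t2 vE].
- exact: eqv_refl.
- exact: eqv_trans wv vu.
- exact: eqv_del.
- exact: eqv_ins.
by apply: eqv_slide; rewrite // ?t2 ?t12 ?t1.
Qed.

Lemma eqv_cat2 p q u v : eqv u v -> eqv (p ++ u ++ q) (p ++ v ++ q).
Proof.
have e a (c b : seq letter) : p ++ (a ++ c ++ b) ++ q = (p ++ a) ++ c ++ b ++ q.
  by rewrite !catA.
elim=> {u v} [u|u v w _ uv _ vw|a l b vl|a l b vl|a l1 l2 l1' l2' b t1 t12 t2 vE].
- exact: eqv_refl.
- exact: eqv_trans uv vw.
- by rewrite (e a [::] b) (e a [:: l] b); apply: eqv_ins.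
- by rewrite (e a [::] b) (e a [:: l] b); apply: eqv_del.
by rewrite (e a [:: l1; l2] b) (e a [:: l1'; l2'] b); apply: eqv_slide.
Qed.

Lemma eqv_cat u u' v v' : eqv u u' -> eqv v v' -> eqv (u ++ v) (u' ++ v').
Proof.
move=> uu vv; have := eqv_cat2 u [::] vv; rewrite !cats0 => /eqv_trans; apply.
exact: (eqv_cat2 [::] v').
Qed.

(** * The group of words modulo [eqv] *)

Definition eval (w : seq letter) : G := \prod_(l <- w) value l.

Lemma eval_cat u v : eval (u ++ v) = eval u * eval v.
Proof. exact: big_cat. Qed.

Lemma eval_cons l v : eval (l :: v) = value l * eval v.
Proof. exact: big_cons. Qed.

Lemma eval_eqv u v : eqv u v -> eval u = eval v.
Proof.
elim=> {u v} // [u v w _ -> //|p l q vl|p l q vl|p l1 l2 l1' l2' q _ _ _ vE].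
- by rewrite !eval_cat eval_cons vl mul1g.
- by rewrite !eval_cat eval_cons vl mul1g.
by rewrite !eval_cat !eval_cons [value l1 * _]mulgA -vE !mulgA.
Qed.

Definition eqvb u v := `[< eqv u v >].

Lemma eqvb_refl : reflexive eqvb.
Proof. by move=> u; apply/asboolP; exact: eqv_refl. Qed.

Lemma eqvb_sym : symmetric eqvb.
Proof. by move=> u v; apply/asboolP/asboolP; exact: eqv_sym. Qed.

Lemma eqvb_trans : transitive eqvb.
Proof. by move=> v u w /asboolP uv /asboolP vw; apply/asboolP/(eqv_trans uv vw). Qed.

Canonical eqv_rel := EquivRel eqvb eqvb_refl eqvb_sym eqvb_trans.

Local Open Scope quotient_scope.

(** A concrete model of the free product: mapping [G] to it turns equalities in [G] into moves on
    words. *)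
Definition word_group := {eq_quot eqv_rel}.
HB.instance Definition _ := Choice.on word_group.

Definition wclass (w : seq letter) : word_group := \pi w.
Definition wrepr (x : word_group) : seq letter := repr x.

Lemma wreprK x : wclass (wrepr x) = x.
Proof. exact: reprK. Qed.

Lemma wclassP u v : wclass u = wclass v <-> eqv u v.
Proof. by split=> [/eqmodP/asboolP|uv] //; apply/eqmodP/asboolP. Qed.

Lemma eqv_repr w : eqv (wrepr (wclass w)) w.
Proof. by apply/wclassP; exact: wreprK. Qed.

Definition inv_letter (l : letter) : letter := Tagged A (tagged l)^-1.

Definition inv_word (w : seq letter) := rev (map inv_letter w).

Lemma value_inv l : value (inv_letter l) = (value l)^-1.
Proof. exact: gmulfV. Qed.

Definition triv_letter j : letter := Tagged A (1 : A j).

Lemma value_triv j : value (triv_letter j) = 1.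
Proof. exact: gmulf1. Qed.

Lemma eqv_cancel l1 l2 : tag l1 = tag l2 -> value l1 * value l2 = 1 -> eqv [:: l1; l2] [::].
Proof.
move=> t v1; apply: (@eqv_trans _ [:: triv_letter (tag l1); triv_letter (tag l1)]).
  by apply: (eqv_slide [::]) => //=; rewrite ?v1 ?value_triv ?mulg1.
apply: eqv_trans (eqv_del [::] [:: _] (value_triv _)) _.
exact: (eqv_del [::] [::] (value_triv _)).
Qed.

Lemma inv_wordK : involutive inv_word.
Proof.
move=> w; rewrite /inv_word map_rev revK -map_comp map_id_in // => -[j a] _.
by rewrite /= /inv_letter /= invgK.
Qed.

Lemma eqv_invl w : eqv (inv_word w ++ w) [::].
Proof.
elim: w => [|l w IHw]; first exact: eqv_refl.
rewrite /inv_word /= rev_cons cat_rcons -[_ :: _ :: w]/([:: inv_letter l; l] ++ w).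
apply: eqv_trans IHw; rewrite -/(inv_word w); apply: (@eqv_cat2 _ _ _ [::]).
by apply: eqv_cancel; rewrite // value_inv mulVg.
Qed.

Lemma eqv_invr w : eqv (w ++ inv_word w) [::].
Proof. by rewrite -{1}[w]inv_wordK; exact: eqv_invl. Qed.

Definition wmul x y := wclass (wrepr x ++ wrepr y).
Definition winv x := wclass (inv_word (wrepr x)).

Lemma wmulE u v : wmul (wclass u) (wclass v) = wclass (u ++ v).
Proof. by apply/wclassP; apply: eqv_cat; exact: eqv_repr. Qed.

Lemma wmulA : associative wmul.
Proof.
by move=> x y z; rewrite -[x]wreprK -[y]wreprK -[z]wreprK !wmulE catA.
Qed.

Lemma wmul1 : left_id (wclass [::]) wmul.
Proof. by move=> x; rewrite -[x]wreprK wmulE. Qed.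

Lemma wmulx1 : right_id (wclass [::]) wmul.
Proof. by move=> x; rewrite -[x]wreprK wmulE cats0. Qed.

Lemma wmulV : left_inverse (wclass [::]) winv wmul.
Proof. by move=> x; rewrite -{2}[x]wreprK wmulE; apply/wclassP; exact: eqv_invl. Qed.

Lemma wmulxV : right_inverse (wclass [::]) winv wmul.
Proof. by move=> x; rewrite -{1}[x]wreprK wmulE; apply/wclassP; exact: eqv_invr. Qed.

HB.instance Definition _ := isGroup.Build word_group wmulA wmul1 wmulx1 wmulV wmulxV.

Lemma wclass_cat u v : wclass (u ++ v) = wclass u * wclass v.
Proof. by rewrite -wmulE. Qed.

Definition inclusion j (a : A j) : word_group := wclass [:: (Tagged A a : letter)].

Lemma inclusion_monoid j : monoid_morphism (@inclusion j).
Proof.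
split; first by apply/wclassP; exact: (eqv_del [::] [::] (value_triv j)).
move=> a b; rewrite -wclass_cat; apply/wclassP.
(* The inserted trivial letter lets a slide distribute the product over two letters. *)
apply: eqv_trans (eqv_ins [::] [:: _] (value_triv j)) _.
by apply: (eqv_slide [::]); rewrite //= value_triv mul1g /value /= gmulfM.
Qed.

HB.instance Definition _ j :=
  isUMagmaMorphism.Build (A j) word_group (@inclusion j) (inclusion_monoid j).

Definition weval (x : word_group) : G := eval (wrepr x).

Lemma weval_class w : weval (wclass w) = eval w.
Proof. exact/eval_eqv/eqv_repr. Qed.

Lemma weval_monoid : monoid_morphism weval.
Proof.
split; first by rewrite weval_class /eval big_nil.
by move=> x y; rewrite -[x]wreprK -[y]wreprK -wclass_cat !weval_class eval_cat.
Qed.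

HB.instance Definition _ := isUMagmaMorphism.Build word_group G weval weval_monoid.

End Letters.

(** * Powers of cyclically reduced words *)

Lemma sum_residues L n i : (i < L)%N -> (\sum_(0 <= m < n * L) (m %% L == i) = n)%N.
Proof.
move=> iL; elim: n => [|n IHn]; first by rewrite big_geq.
rewrite mulSnr (@big_cat_nat _ _ _ (n * L)) ?leq_addr //= IHn -[RHS]addn1; congr addn.
rewrite -{1}[(n * L)%N]add0n big_addn addKn big_mkord (bigD1 (Ordinal iL)) //=.
rewrite [(i + _)%N]addnC modnMDl modn_small // eqxx big1 // => j ji.
rewrite [(j + _)%N]addnC modnMDl modn_small // (_ : (_ == _) = false) //.
by apply: contraNF ji => /eqP e; apply/eqP/val_inj.
Qed.

(** As [f] is constant on the cycles through [t], different values mean different cycles. *)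
Lemma card_porbit_transversal (X : finType) (p : {perm X}) (f : X -> nat) (t : seq X) :
  uniq (map f t) -> (forall x, x \in t -> forall i, f ((p ^+ i) x) = f x) ->
  #|[set porbit p x | x in t]| = size t.
Proof.
move=> ut ft; pose f' (o : {set X}) := if [pick y in o] is Some y then f y else 0%N.
have fE : map f t = map f' (map (porbit p) t).
  rewrite -map_comp; apply/eq_in_map => x xt /=; rewrite /f'.
  case: pickP => [y /porbitP[i ->]|/(_ x)]; first by rewrite ft.
  by rewrite porbit_id.
have/card_uniqP : uniq (map (porbit p) t) by apply: (@map_uniq _ _ f'); rewrite -fE.
rewrite size_map => <-; apply: eq_card => o.
by apply/imsetP/mapP => -[x xt ->]; exists x.
Qed.

(** * From commutators to charts, and the lower bound for reduced words *)

Section FreeProduct.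
Variables (J : Type) (A : J -> groupType) (G : groupType).
Variable iota : forall j, {ghom A j -> G}.
Hypothesis Gfree : is_free_product iota.
Local Notation letter := (letter A).
Local Notation eval := (eval iota).
Local Notation value := (value iota).
Local Notation bounds := (bounds iota).

Lemma word_group_hom :
  exists phi : {ghom G -> word_group iota}, forall w, phi (eval w) = wclass iota w.
Proof.
have [[phi phiE] _] := Gfree (fun j => @inclusion J A G iota j : {ghom A j -> word_group iota}).
exists phi; elim=> [|l w IHw]; first by rewrite /eval big_nil gmulf1.
rewrite eval_cons gmulfM IHw -[l :: w]/([:: l] ++ w) wclass_cat; congr (_ * _).
by rewrite /value phiE /= /inclusion; case: l.
Qed.

Lemma eval_eqvP u v : eval u = eval v -> eqv iota u v.
Proof.
by have [phi phiE] := word_group_hom => e; apply/wclassP; rewrite -!phiE e.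
Qed.

(** By the uniqueness clause, evaluating the image of [g] in the word group returns [g]; a trivial
    letter from the factor [j] makes the word nonempty. *)
Lemma eval_surj (j : J) (g : G) : exists2 w, eval w = g & w != [::].
Proof.
have [phi phiE] := word_group_hom.
have [_ uniq] := Gfree iota.
have e : (@weval J A G iota \o phi) g = g.
  apply: (uniq (@weval J A G iota \o phi) idfun) => // i a.
  have -> : iota i a = eval [:: (Tagged A a : letter)].
    by rewrite /eval big_seq1.
  by rewrite /= phiE weval_class.
exists (triv_letter A j :: wrepr (phi g)) => //.
by rewrite eval_cons value_triv mul1g -[RHS]e.
Qed.

(* For eval w = [x, y] h, the word y^-1 x^-1 y x w evaluates to h; cutting its boundary
   into y^-1 x^-1 y and x w and gluing again along x^-1 costs one handle. *)
Lemma bounds_commutators k w :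
  w != [::] -> prod_of_commutators k (eval w) -> bounds [:: w] k.*2.
Proof.
elim: k w => [|k IHk] w w0 [s [sk wE]].
  have j : J by case: w w0 {wE} => // l _ _; exact: tag l.
  have : bounds ([::] ++ [:: triv_letter A j] :: [::]) 0.
    by apply: bounds_trivial; exact: value_triv.
  have wnil : eqv iota [::] w.
    by apply: eval_eqvP; rewrite wE (size0nil sk) /eval !big_nil.
  move/(@bounds_eqv _ _ _ iota [::] w [:: triv_letter A j] [::] 0 wnil isT).
  move/bounds_rot; apply: bounds_del => //; exact: value_triv.
case: s sk wE => // -[x y] s [sk] /=; rewrite big_cons /= => wE.
have j : J by case: w w0 {wE} => // l _ _; exact: tag l.
have [xw xE x0] := eval_surj j x; have [yw yE y0] := eval_surj j y.
have [xi xiE xi0] := eval_surj j x^-1; have [yi yiE yi0] := eval_surj j y^-1.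
pose h := \prod_(p <- s) [~ p.1, p.2].
have : bounds [:: (yi ++ xi ++ yw) ++ (xw ++ w)] k.*2.
  apply: IHk; first by case: yi yi0 {yiE}.
  exists s; split=> //; rewrite !eval_cat xE yE xiE yiE wE.
  by rewrite commgEl conjgE !gnorm.
move/bounds_split; rewrite doubleS => /(_ _ _) split1.
have {split1} : bounds [:: yi ++ (xi ++ yw); xw ++ w] k.*2.+2.
  by apply: split1; [case: yi yi0 {yiE} | case: xw x0 {xE}].
move/bounds_rot; rewrite -catA => /bounds_rot.
have yyi : eqv iota (yw ++ yi) [::].
  by apply: eval_eqvP; rewrite eval_cat yE yiE mulgV /eval big_nil.
move/(bounds_eqv yyi xi0) => /= /bounds_merge h2.
have xxi : eqv iota (xi ++ xw) [::].
  by apply: eval_eqvP; rewrite eval_cat xE xiE mulVg /eval big_nil.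
apply: (bounds_eqv xxi w0); rewrite -catA; apply: h2 => //.
by case: xw x0 {xE xxi}.
Qed.

Section CyclicallyReduced.
Variables (w : seq letter) (N : nat).
Let L := size w.
Hypothesis w_gt1 : (1 < L)%N.
Hypothesis N_gt0 : (0 < N)%N.
Hypothesis w_reduced : forall (l0 : letter) i, (i < L)%N ->
  tag (nth l0 w (i.+1 %% L)) <> tag (nth l0 w i).
Hypothesis w_order : forall l d, l \in w -> (0 < d)%N -> value l ^+ d = 1 -> (N <= d)%N.

Definition power_word n := flatten (nseq n w).

Lemma size_power_word n : size (power_word n) = (n * L)%N.
Proof. by elim: n => //= n IHn; rewrite size_cat IHn mulSn. Qed.

Lemma nth_power_word l0 n i : (i < n * L)%N -> nth l0 (power_word n) i = nth l0 w (i %% L).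
Proof.
elim: n i => //= n IHn i; rewrite nth_cat mulSn -/L.
case: (ltnP i L) => [iL _|Li iM]; first by rewrite modn_small.
by rewrite IHn ?ltn_subLR // -[in RHS](subnK Li) modnDr.
Qed.

Lemma eval_power_word n : eval (power_word n) = eval w ^+ n.
Proof.
elim: n => [|n IHn]; first by rewrite /eval big_nil.
by rewrite expgS -IHn -eval_cat.
Qed.

(** The residue of a letter is its position in [w]; the Euler count bounds [F + K] from below and
    [corner_count] bounds it from above. *)
Lemma reduced_power_bound n k :
  (0 < n)%N -> prod_of_commutators k (eval w ^+ n) ->
  (n < k.*2 + (n %/ N).*2)%N.
Proof.
move=> n0; rewrite -eval_power_word => Pk.
have W0 : power_word n != [::].
  by rewrite -size_eq0 size_power_word muln_eq0; lia.
have [X [lab [cs [s [p [csE ch]]]]]] := bounds_commutators W0 Pk.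
case: cs csE ch => [|c [|? ?]] //= [cE] [uX allX sX pX [F [K [fF cK cnt]]]].
have {}uX : uniq c by move: uX; rewrite /= cats0.
have {}allX x : x \in c by have := allX x; rewrite /= cats0.
have l0 : letter by move: w_gt1; rewrite /L; case: (w) => // l _ _; exact: l.
have szc : size c = (n * L)%N by rewrite -size_power_word cE size_map.
have cX : #|X| = (n * L)%N.
  by rewrite -szc -(card_uniqP uX); apply: eq_card => x; rewrite allX.
pose r x := (index x c %% L)%N.
have idx x : (index x c < n * L)%N by rewrite -szc index_mem.
have r_lt x : (r x < L)%N by rewrite ltn_mod; lia.
have labE x : lab x = nth l0 w (r x).
  rewrite /r -(nth_power_word l0 (idx x)) cE (nth_map x) ?index_mem //.
  by rewrite nth_index.
have idx_s x : index (s x) c = ((index x c).+1 %% (n * L))%N.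
  have e : s x = nth x (rot 1 c) (index x c).
    by rewrite -sX ?mem_head // (nth_map x) ?index_mem // nth_index.
  have := idx x; rewrite {}e -szc; case: (c) (allX x) uX => // y t _ ut.
  rewrite rot1_cons /=; set i := index x (y :: t) => it.
  rewrite nth_rcons; move: it; rewrite /= ltnS leq_eqVlt => /orP[/eqP ->|it].
    by rewrite ltnn eqxx modnn /= eqxx.
  by rewrite it modn_small ?ltnS //; apply: (@index_uniq _ x i.+1 (y :: t)).
have r_s x : r (s x) = if (r x).+1 == L then 0%N else (r x).+1.
  rewrite /r idx_s modn_dvdm ?dvdn_mull // -addn1 -modnDml addn1.
  case: eqP => [->|/eqP ne]; first by rewrite modnn.
  by rewrite modn_small // ltn_neqAle ne ltn_mod; lia.
pose kappa := s * p^-1.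
have pk x : p (kappa x) = s x by rewrite permM permKV.
(* As [p] preserves tags, equal residues would put two cyclically adjacent letters of [w] into one
   factor. *)
have r_k x : r (kappa x) != r x.
  apply/eqP => e; have := pX (kappa x); rewrite pk !labE e r_s.
  have := @w_reduced l0 _ (r_lt x); case: eqP => [->|ne]; first by rewrite modnn.
  by rewrite modn_small //; have := r_lt x; lia.
case: fF => Y [h [f [Yp fp hp [sF /andP[YF uF] szF]]]].
case: cK => g g_sp [sG /andP[_ uG] szG].
have pow_p i x : Y x -> Y ((p ^+ i) x) /\ f ((p ^+ i) x) = f x.
  move=> Yx; elim: i => [|i [IY If]]; first by rewrite expg0 perm1.
  by rewrite expgSr permM Yp fp.
pose S := [set porbit p x | x in sF].
have cS : (F <= #|S|)%N.
  rewrite (card_porbit_transversal uF) // => x xF i.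
  by have [] := pow_p i x (allP YF x xF).
have cK : (K <= #|porbits kappa|)%N.
  (* The corner colouring composed with [s] is constant on the cycles of [kappa], so each colour
     yields its own cycle. *)
  have gk x : g (s (kappa x)) = g (s x) by rewrite g_sp pk.
  have gki x i : g (s ((kappa ^+ i) x)) = g (s x).
    by elim: i => [|i IHi]; rewrite ?expg0 ?perm1 // expgSr permM gk.
  pose t := map s^-1 sG.
  have ut : uniq (map (g \o s) t).
    rewrite -map_comp (_ : map _ sG = map g sG) //; apply: eq_map => x /=.
    by rewrite permKV.
  apply: leq_trans szG _; rewrite -(size_map s^-1) -(card_porbit_transversal ut (p := kappa)).
    by apply: subset_leq_card; apply/subsetP => o /imsetP[x _ ->]; exact: imset_f.
  by move=> x _ i /=; exact: gki.
have S_orbits : S \subset porbits p.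
  by apply/subsetP => o /imsetP[x _ ->]; exact: imset_f.
(* On a constant cycle all labels are the same letter; following the potential once around shows
   that its power by the cycle length is trivial. *)
have S_const x : porbit p x \in S ->
    (forall y, y \in porbit p x -> r (p y) = r y) -> (N <= #|porbit p x|)%N.
  move=> /imsetP[y yF ->] rc.
  have Yy := allP YF y yF; set i := #|_|.
  have rp j : r ((p ^+ j) y) = r y.
    elim: j => [|j IHj]; first by rewrite expg0 perm1.
    by rewrite expgSr permM rc ?mem_porbit.
  have hpi j : h ((p ^+ j) y) = h y * value (lab y) ^+ j.
    elim: j => [|j IHj]; first by rewrite expg0 perm1 mulg1.
    have [Yj _] := pow_p j y Yy.
    have lj : lab ((p ^+ j) y) = lab y by rewrite !labE rp.
    by rewrite expgSr permM hp // IHj lj -mulgA -expgSr.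
  have ly : lab y \in w by rewrite labE mem_nth.
  apply: (w_order ly); first by rewrite card_gt0; apply/set0Pn; exists y; exact: porbit_id.
  apply: (mulgI (h y)); rewrite -hpi mulg1; congr (h _).
  by rewrite permX; exact: iter_porbit.
have fiber i : (i < L)%N -> (\sum_x (r x == i) = n)%N.
  move=> iL.
  have -> : (\sum_x (r x == i) = \sum_(x <- c) (r x == i))%N.
    by rewrite (big_uniq _ uX) /=; apply: eq_bigl => x; rewrite allX.
  have nL : (0 < n * L)%N by rewrite muln_gt0 n0; lia.
  have x0 : X by case: (c) szc => [e|x t _]; [rewrite -e in nL | exact: x].
  rewrite (big_nth x0) szc -[RHS](sum_residues n iL); apply: eq_big_nat => j /andP[_ jn].
  by rewrite /r index_uniq // szc.
have := corner_count r_lt pk r_s r_k fiber _ S_orbits S_const N_gt0.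
have L0 : (0 < L)%N by lia.
move=> /(_ L0) cc; have c1 : (n * L + 1 <= F + K + k.*2)%N by rewrite -cX.
by move: cc c1 cS cK; rewrite cX mul2n; move: #|S| #|porbits kappa| => ? ?; lia.
Qed.

End CyclicallyReduced.

End FreeProduct.

(** * Orders of elements and factors *)

Local Open Scope classical_set_scope.
Local Open Scope group_scope.

Lemma min_enatP (S : set enat) x0 : S x0 ->
  S (min_enat S) /\ forall y, S y -> le_enat (min_enat S) y.
Proof.
move=> Sx0; suff [x Px] : exists x, S x /\ forall y, S y -> le_enat x y.
  exact: (@xgetPex _ None [set x | S x /\ forall y, S y -> le_enat x y]) (ex_intro _ x Px).
have [[m Sm]|no] := pselect (exists m, S (Some m)); last first.
  exists x0; split=> // y Sy; case: y Sy => [m Sm|]; last by case: (x0).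
  by case: no; exists m.
have exm : exists m, `[< S (Some m) >] by exists m; apply/asboolP.
exists (Some (ex_minn exm)); case: ex_minnP => k /asboolP Sk kmin.
split=> // -[l Sl|] //=; exact/kmin/asboolP.
Qed.

Section Orders.
Variable G : groupType.
Implicit Types g : G.

Lemma expg_mod_order g d i : g ^+ d = 1 -> g ^+ (i %% d) = g ^+ i.
Proof.
move=> gd; rewrite [in RHS](divn_eq i d) expgnDr mulnC expgnA gd expg1n mul1g.
by [].
Qed.

Lemma card_cyclic_subgroup g d :
  (0 < d)%N -> g ^+ d = 1 -> (forall i, (0 < i < d)%N -> g ^+ i <> 1) ->
  card_enat (cyclic_subgroup g) = Some d.
Proof.
move=> d0 gd dmin; pose s := [seq g ^+ i | i <- iota 0 d].
have us : uniq s.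
  rewrite map_inj_in_uniq ?iota_uniq // => i j; rewrite !mem_iota /= !add0n.
  wlog ij : i j / (i <= j)%N.
    move=> W id jd e; case/orP: (leq_total i j) => h; first exact: W.
    by apply/esym/W.
  move=> id jd e; case: (ltngtP i j) ij => // ij _; case: (dmin (j - i)%N); first by lia.
  by apply: (mulgI (g ^+ i)); rewrite -expgnDr subnKC ?mulg1 // ltnW.
have cE : cyclic_subgroup g = [set` [fset x in s]%fset].
  apply/seteqP; split=> x /=; rewrite !finmap.inE /=.
    have pow i : g ^+ i \in s.
      by rewrite -(expg_mod_order i gd); apply: map_f; rewrite mem_iota /= add0n ltn_mod.
    case=> m [->|->]; first exact: pow.
    suff -> : g ^- m = g ^+ (d.-1 * m) by exact: pow.
    apply: (mulgI (g ^+ m)); rewrite mulgV -expgnDr -mulSn prednK // expgnA gd.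
    by rewrite expg1n.
  by case/mapP => i _ ->; exists i; left.
rewrite /card_enat cE asboolT; last exact: finite_fset.
by rewrite set_fsetK card_fseq undup_id // size_map size_iota.
Qed.

(** Otherwise the powers of [g] would be distinct and embed the natural numbers in a finite set. *)
Lemma finite_cyclic_order g :
  finite_set (cyclic_subgroup g) -> exists2 d, (0 < d)%N & g ^+ d = 1.
Proof.
move=> fin; apply: contrapT => no; apply: infinite_nat.
have -> : [set: nat] = (fun i => g ^+ i) @^-1` cyclic_subgroup g.
  by apply/seteqP; split=> i // _; exists i; left.
apply: finite_preimage fin => i j _ _ e; apply: contrapT => ij; apply: no.
wlog lij : i j e ij / (i < j)%N.
  move=> W; case: (ltngtP i j) => [h|h|//]; first exact: (W i j).
  by apply: (W j i) => // /esym.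
exists (j - i)%N; first by rewrite subn_gt0.
by apply: (mulgI (g ^+ i)); rewrite -expgnDr subnKC ?mulg1 // ltnW.
Qed.

Lemma card_cyclic_le g d : (0 < d)%N -> g ^+ d = 1 ->
  exists m, [/\ card_enat (cyclic_subgroup g) = Some m, (m <= d)%N, (0 < m)%N & g ^+ m = 1].
Proof.
move=> d0 gd; have ex : exists m, (0 < m)%N && (g ^+ m == 1).
  by exists d; rewrite d0 gd eqxx.
case: (ex_minnP ex) => m /andP[m0 /eqP gm] mmin; exists m; split=> //.
  apply: card_cyclic_subgroup => // i /andP[i0 im] gi.
  by have := mmin i; rewrite i0 gi eqxx => /(_ isT); rewrite leqNgt im.
by apply: mmin; rewrite d0 gd eqxx.
Qed.

Lemma N_min_Some N : N_min G = Some N ->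
  [/\ (1 < N)%N, exists2 g : G, g != 1 & g ^+ N = 1 &
      forall g d, g != 1 -> (0 < d)%N -> g ^+ d = 1 -> (N <= d)%N].
Proof.
move=> NN.
have [g1 g1n] : exists g1 : G, g1 != 1.
  apply: contrapT => no; move: NN; rewrite /N_min /min_enat xgetPN // => x [[g gn] _ _].
  by case: no; exists g.
pose S := [set x | exists2 g : G, g != 1 & x = card_enat (cyclic_subgroup g)].
have S_in (h : G) : h != 1 -> S (card_enat (cyclic_subgroup h)) by exists h.
have [[g gn gN] minN] := min_enatP (S_in g1 g1n).
rewrite -/(N_min G) NN in gN minN.
have fin : finite_set (cyclic_subgroup g).
  by move: gN; rewrite /card_enat; case: asboolP.
have [d d0 gd] := finite_cyclic_order fin.
have [m [mE _ m0 gm]] := card_cyclic_le d0 gd.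
have {mE} mE : m = N by move: gN; rewrite mE => -[].
rewrite mE in m0 gm; split.
- by case: N m0 gm {NN gN minN mE} => [|[|N]] //; rewrite expg1 => _ g1E; rewrite g1E eqxx in gn.
- by exists g.
move=> h e hn e0 he; have [l [lE le _ _]] := card_cyclic_le e0 he.
by have := minN _ (S_in h hn); rewrite lE => /leq_trans; apply.
Qed.

Lemma N_min_None : N_min G = None ->
  forall g d, g != 1 -> (0 < d)%N -> g ^+ d <> 1.
Proof.
move=> NN g d gn d0 gd; have [m [mE _ _ _]] := card_cyclic_le d0 gd.
pose S := [set x | exists2 g : G, g != 1 & x = card_enat (cyclic_subgroup g)].
have Sg : S (card_enat (cyclic_subgroup g)) by exists g.
have [_ /(_ _ Sg)] := min_enatP Sg.
by rewrite -/(N_min G) NN mE.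
Qed.

Lemma clP g k : prod_of_commutators k g ->
  exists m, [/\ cl g = Some m, (m <= k)%N & prod_of_commutators m g].
Proof.
move=> Pk; have := @min_enatP [set x | exists2 k, x = Some k & prod_of_commutators k g] (Some k).
case; first by exists k.
rewrite -/(cl g) => -[m mE Pm] /(_ (Some k)) h; exists m; split=> //.
by move: h; rewrite mE; apply; exists k.
Qed.

Lemma cl_Some g m : cl g = Some m -> prod_of_commutators m g.
Proof.
rewrite /cl /min_enat; case: xgetP => // x -> [[k -> Pk] _] [<-] //.
Qed.

End Orders.

(** * Projections to the factors, reduction of words and torsion *)

Section Factors.
Variables (J : Type) (A : J -> groupType) (G : groupType).
Variable iota : forall j, {ghom A j -> G}.
Hypothesis Gfree : is_free_product iota.
Local Notation letter := (letter A).
Local Notation eval := (eval iota).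
Local Notation value := (value iota).

(** For fixed [j] these maps assemble to the retraction of [G] onto [A j]. *)
Definition factor_map (i j : J) : A i -> A j :=
  match pselect (i = j) with
  | left e => match e in _ = k return A i -> A k with erefl => id end
  | right _ => fun=> 1
  end.

Lemma factor_map_monoid i j : monoid_morphism (@factor_map i j).
Proof.
rewrite /factor_map; case: pselect => [e|_]; first by case: _ / e.
by split=> // x y; rewrite mulg1.
Qed.

HB.instance Definition _ i j :=
  isUMagmaMorphism.Build (A i) (A j) (@factor_map i j) (factor_map_monoid i j).

Lemma factor_map_id i (a : A i) : factor_map i a = a.
Proof.
rewrite /factor_map; case: pselect => // e.
by rewrite (Prop_irrelevance e erefl).
Qed.

Lemma factor_map_other i j (a : A i) : i <> j -> factor_map j a = 1.
Proof. by rewrite /factor_map; case: pselect. Qed.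

Lemma projection j : exists pr : {ghom G -> A j}, forall i a, pr (iota i a) = factor_map j a.
Proof.
by have [[pr prE] _] := Gfree (fun i => @factor_map i j : {ghom A i -> A j}); exists pr.
Qed.

Lemma iota_neq1 j (a : A j) : a != 1 -> iota j a != 1.
Proof.
have [pr prE] := projection j; apply: contraNneq => a1.
by rewrite -(factor_map_id a) -prE a1 gmulf1.
Qed.

(* Cyclically reduced, with at least two letters. *)
Definition reduced (w : seq letter) :=
  [/\ (1 < size w)%N,
      forall l0 i, (i < size w)%N -> tag (nth l0 w (i.+1 %% size w)) <> tag (nth l0 w i) &
      forall l, l \in w -> value l != 1].

Lemma eval_rot (w : seq letter) i : exists x, eval w = eval (rot i w) ^ x.
Proof.
exists (eval (take i w))^-1; rewrite -{1}(cat_take_drop i w) /rot !eval_cat.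
by rewrite conjgE invgK !mulgA mulgK.
Qed.

(** Induction on the length: after a rotation, which only conjugates, a trivial letter is dropped or
    two cyclically adjacent letters of one factor are multiplied. *)
Lemma reduced_conj (w : seq letter) :
  exists w' x, eval w = eval w' ^ x /\ ((size w' <= 1)%N \/ reduced w').
Proof.
have [n] := ubnP (size w); elim: n w => // n IHn w wn.
have step i w' : eval (rot i w) = eval w' -> (size w' < size w)%N ->
    exists w' x, eval w = eval w' ^ x /\ ((size w' <= 1)%N \/ reduced w').
  move=> e sw; have [x ->] := eval_rot w i.
  have [|u [y [uE uP]]] := IHn w'; first by rewrite (leq_trans sw).
  by exists u, (y * x); rewrite e uE conjgM.
case: (leqP (size w) 1) => [w1|w1]; first by exists w, 1; rewrite conjg1; split=> //; left.
have [[l lw l1]|nontriv] := pselect (exists2 l, l \in w & value l = 1).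
  have [i [w' rw]] : exists i w', rot i w = l :: w'.
    by have [i w' rw] := rot_to lw; exists i, w'.
  apply: (step i w'); first by rewrite rw eval_cons l1 mul1g.
  by rewrite -(size_rot i w) rw.
have [[l0 [i [iw tE]]]|alt] := pselect (exists l0 i, (i < size w)%N /\
    tag (nth l0 w (i.+1 %% size w)) = tag (nth l0 w i)); last first.
  exists w, 1; rewrite conjg1; split=> //; right; split=> //.
    by move=> l0 i iw tE; apply: alt; exists l0, i.
  by move=> l lw; apply/eqP => l1; apply: nontriv; exists l.
have [w' rw] : exists w', rot i w = nth l0 w i :: nth l0 w (i.+1 %% size w) :: w'.
  rewrite /rot (drop_nth l0 iw); case: (ltngtP i.+1 (size w)) => [h||h]; last 2 first.
  - by lia.
  (* Here the pair consists of the last letter and the first one. *)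
  - rewrite h modnn drop_size /=; case: i h {iw tE} => [|i] h; first by rewrite -h in w1.
    by case: (w) w1 => // l u _; exists (take i u).
  by rewrite (drop_nth l0 h) modn_small //=; eexists.
move: tE rw; case: (nth l0 w i) => j a; case: (nth l0 w _) => k b /= e.
case: _ / e a => a rw.
apply: (step i ((Tagged A (a * b) : letter) :: w')); last by rewrite -(size_rot i w) rw.
by rewrite rw !eval_cons mulgA /value /= gmulfM.
Qed.

Lemma reduced_bound w N n k : reduced w -> (0 < N)%N ->
  (forall l d, l \in w -> (0 < d)%N -> value l ^+ d = 1 -> (N <= d)%N) ->
  (0 < n)%N -> prod_of_commutators k (eval w ^+ n) -> (n < k.*2 + (n %/ N).*2)%N.
Proof.
move=> [w1 walt _] N0 wN n0; apply: reduced_power_bound => //.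
Qed.

(** With [N = 2] and [k = 0] the bound would read [n < (n %/ 2).*2]. *)
Lemma reduced_torsionfree w n : reduced w -> (0 < n)%N -> eval w ^+ n <> 1.
Proof.
move=> red n0 e; have [w1 _ wn] := red.
have := @reduced_bound w 2 n 0 red isT _ n0; rewrite e => /(_ _ (prod_comm1 G)).
suff h : forall l d, l \in w -> (0 < d)%N -> value l ^+ d = 1 -> (2 <= d)%N.
  by move/(_ h); rewrite divn2 -[X in _ -> X]/False; have := odd_double_half n; lia.
move=> l [|[|d]] // lw _; rewrite expg1 => l1.
by have := wn l lw; rewrite l1 eqxx.
Qed.

Lemma reduced_of_not_conj (j : J) g : ~ conj_to_factor iota g ->
  exists w x, g = eval w ^ x /\ reduced w.
Proof.
move=> nc; have [u uE _] := eval_surj Gfree j g.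
have [w [x [wE [w1|red]]]] := reduced_conj u; last by exists w, x; rewrite -uE.
case: nc; rewrite -uE wE; case: w w1 {wE} => [|l [|//]] _.
  by exists j, 1, x; rewrite gmulf1 /eval big_nil.
by exists (tag l), (tagged l), x; rewrite /eval big_seq1.
Qed.

Lemma torsion_conj (j : J) g n : (0 < n)%N -> g ^+ n = 1 -> conj_to_factor iota g.
Proof.
move=> n0 gn; apply: contrapT => /(reduced_of_not_conj j)[w [x [gE red]]].
apply: (reduced_torsionfree red n0); apply: (@conjg_inj _ x).
by rewrite conjXg -gE gn conj1g.
Qed.

(** Every projection to a factor kills [a] or [b], so the commutator could only be conjugate to [1];
    but its four-letter word is reduced, hence nontrivial. *)
Lemma commutator_not_conj i j (a : A i) (b : A j) : i <> j -> a != 1 -> b != 1 ->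
  ~ conj_to_factor iota [~ iota i a, iota j b].
Proof.
move=> ij a1 b1 [k [c [x e]]].
have c1 : c = 1.
  have [pr prE] := projection k; have := congr1 pr e.
  rewrite gmulfR gmulfJ !prE (factor_map_id c).
  have [ik|ik] := pselect (i = k).
    rewrite (factor_map_other b); last by rewrite -ik; exact: nesym.
    by rewrite commg1 => /esym/eqP; rewrite conjg_eq1 => /eqP.
  by rewrite (factor_map_other a ik) comm1g => /esym/eqP; rewrite conjg_eq1 => /eqP.
pose w : seq letter := [:: Tagged A a^-1; Tagged A b^-1; Tagged A a; Tagged A b].
apply: (@reduced_torsionfree w 1) => //; last first.
  rewrite expg1 /eval /w !big_cons big_nil mulg1 /value /= !gmulfV.
  by rewrite -/(conjg _ _) -commgEl e c1 gmulf1 conj1g.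
have ji : j <> i by exact: nesym.
split=> // [l0 [|[|[|[|]]]] //|l].
by rewrite !inE => /or4P[] /eqP ->; rewrite iota_neq1 ?invg_eq1.
Qed.

Lemma k_min_between n lo hi g0 :
  (forall g k, ~ conj_to_factor iota g -> prod_of_commutators k (g ^+ n) -> (lo <= k)%N) ->
  ~ conj_to_factor iota g0 -> prod_of_commutators hi (g0 ^+ n) ->
  exists m, k_min iota n = Some m /\ (lo <= m <= hi)%N.
Proof.
move=> lb nc0 /clP[m0 [m0E m0hi _]].
pose S := [set x | exists2 g : G, ~ conj_to_factor iota g & x = cl (g ^+ n)].
have S0 : S (Some m0) by exists g0.
have [[g nc gE] /(_ _ S0)] := min_enatP S0.
rewrite -/(k_min iota n) in gE *; case kE : (k_min iota n) gE => [m|] // gE /= mm0.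
exists m; split=> //; rewrite (leq_trans mm0 m0hi) andbT; apply: lb nc _.
exact/cl_Some/esym.
Qed.

End Factors.

(* Truncated subtraction is harmless: N_min G is at least 2, so
   divn_enat n (N_min G) <= n %/ 2. *)
Theorem theorem1 (J : Type) (A : J -> groupType) (G : groupType)
    (iota : forall j, {ghom A j -> G}) (n : nat)
    (Gfree : is_free_product iota)
    (two_factors : exists i j : J,
       [/\ i <> j, nontrivial (A i) & nontrivial (A j)])
    (n_gt0 : (0 < n)%N) :
  (k_min iota n = Some (n %/ 2 - divn_enat n (N_min G) + 1)%N \/
   k_min iota n = Some (n %/ 2 - divn_enat n (N_min G) + 2)%N) /\
  ([\/ ~~ odd n /\ odd (divn_enat n (N_min G)),
       dvdn_enat (N_min G) n,
       le_enat (Some n) (N_min G)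
     | N_min G = Some 2%N] ->
   k_min iota n = Some (n %/ 2 - divn_enat n (N_min G) + 1)%N).
Proof.
have [i0 [j0 [ij0 [a0 a0n] [b0 b0n]]]] := two_factors.
have lower N g k : (1 < N)%N ->
    (forall (h : G) d, h != 1 -> (0 < d)%N -> h ^+ d = 1 -> (N <= d)%N) ->
    ~ conj_to_factor iota g -> prod_of_commutators k (g ^+ n) ->
    (n %/ 2 - n %/ N + 1 <= k)%N.
  move=> N1 Nmin /(reduced_of_not_conj Gfree i0)[w [x [-> red]]] Pk.
  have [_ _ wn] := red.
  have : prod_of_commutators k (eval iota w ^+ n).
    by move/(prod_comm_conj x^-1): Pk; rewrite -conjXg conjgK.
  have := @reduced_bound _ _ _ iota Gfree w N n k red (ltnW N1).
  move=> h /h {h} h; have {h} := h _ n_gt0.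
  have q2 : (n %/ N <= n %/ 2)%N by rewrite leq_div2l.
  have n2 : (n %/ 2 = n./2)%N by rewrite divn2.
  move=> h; have {h} : (n < k.*2 + (n %/ N).*2)%N.
    by apply: h => l d lw; apply: Nmin; exact: wn.
  by rewrite n2 in q2 *; have := odd_double_half n; move: (n %/ N)%N q2 => q; lia.
case NE : (N_min G) => [N|] /=.
  have [N1 [g gn gN] Nmin] := N_min_Some NE.
  (* An element of minimal order is conjugate to some [a] in a factor; a nontrivial [b] of another
     factor then gives [[a, b] = u * v] with [u = a^-1] and [v = a ^ b]. *)
  have [i [a [x gE]]] := torsion_conj Gfree i0 (ltnW N1) gN.
  have aN : iota i a ^+ N = 1.
    by apply: (@conjg_inj _ x); rewrite conjXg -gE gN conj1g.
  have an : a != 1 by apply: contraNneq gn => a1; rewrite gE a1 gmulf1 conj1g.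
  have [j [b [ij bn]]] : exists j (b : A j), i <> j /\ b != 1.
    have [e|ne] := pselect (i = i0); last by exists i0, a0.
    by exists j0, b0; rewrite e.
  have nc := commutator_not_conj Gfree ij an bn.
  have uN : (iota i a)^-1 ^+ N = 1 by rewrite expVgn aN invg1.
  have vE : iota i a ^ iota j b = (iota i a)^-1^-1 ^ iota j b by rewrite invgK.
  have [up2 up1] := prod_comm_pow_commutator_gen n vE N1 uN.
  rewrite -commgEl in up2 up1.
  have lb g' k := lower N g' k N1 Nmin.
  split.
    have [m [-> /andP[lo hi]]] := k_min_between lb nc up2.
    have [->|->] : m = (n %/ 2 - n %/ N + 1)%N \/ m = (n %/ 2 - n %/ N + 2)%N by lia.
      by left.
    by right.
  move=> cond; have [|m [-> /andP[lo hi]]] := k_min_between lb nc (up1 _).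
    by case: cond => [?|?|?|[->]]; tauto.
  by congr Some; lia.
have nc := commutator_not_conj Gfree ij0 a0n b0n.
have vE : iota i0 a0 ^ iota j0 b0 = (iota i0 a0)^-1^-1 ^ iota j0 b0 by rewrite invgK.
have up := prod_comm_uv_pow vE n; rewrite -commgEl in up.
have lb g k : ~ conj_to_factor iota g -> prod_of_commutators k (g ^+ n) -> (n./2.+1 <= k)%N.
  (* Without torsion [lower] applies with any [N > 1]; the choice [n.+2] makes the quotient
     vanish. *)
  move=> ncg Pk; have : (n %/ 2 - n %/ n.+2 + 1 <= k)%N.
    by apply: lower ncg Pk => // h d hn d0 /(N_min_None NE hn d0).
  by rewrite (@divn_small n n.+2) ?divn2 ?subn0 ?addn1 ?ltnS ?leqnSn //; lia.
have [m [-> /andP[lo hi]]] := k_min_between lb nc up.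
have -> : m = (n %/ 2 - 0 + 1)%N by rewrite divn2; lia.
by split=> //; left.
Qed.
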